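(* For every fixed $r\in(0,\infty)$, $r\ne1$, we have $$\lim_{n\to\infty}\|P_n^r-P_n^1\|_{\mathrm{TV}}=1,$$ and hence the measures $P_n^r$ and $P_n^1$ on $\Pi_n$ are asymptotically singular with respect to each other as $n\to\infty$.
   Context: A convex lattice polygonal line $\Gamma$ is a piecewise linear path in the plane with finitely many edges, starting at the origin $0=(0,0)$, with vertices in $\mathbb Z_+^2$ ($\mathbb Z_+=\{0,1,2,\dots\}$), such that the inclination angle of its consecutive edges strictly increases and stays in $[0,\pi/2]$. For $n=(n_1,n_2)\in\mathbb Z_+^2$, $\Pi_n$ is the (finite) set of convex lattice polygonal lines whose right endpoint is $n$. For $0<r<\infty$ and $k\in\mathbb Z_+$ put $b_k^r=\binom{r+k-1}{k}=\frac{r(r+1)\cdots(r+k-1)}{k!}$ (with $b_0^r=1$). For $\Gamma\in\Pi_n$ put $b^r(\Gamma)=\prod_{e_i\in\Gamma}b_{k_i}^r$, the product being over all edges $e_i$ of $\Gamma$, where $k_i$ is the number of lattice points on $e_i$ except its left endpoint. The probability measure $P_n^r$ on $\Pi_n$ is $P_n^r(\Gamma)=b^r(\Gamma)/\sum_{\Gamma'\in\Pi_n}b^r(\Gamma')$; in particular $P_n^1$ is the uniform distribution on $\Pi_n$. The total variation distance is $\|\tilde P_n-P_n\|_{\mathrm{TV}}=\sup_{A\subset\Pi_n}|\tilde P_n(A)-P_n(A)|$. The limit $n\to\infty$ means $n_1,n_2\to\infty$ with $n_1/n_2$ bounded away from $0$ and $\infty$. ''Asymptotically singular'' means precisely that the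 total variation distance tends to $1$. *)

(* Defs.v *)
From HB Require Import structures.
From mathcomp Require Import all_boot all_order all_algebra.
From mathcomp Require Import finmap zify.
From mathcomp Require Import all_classical all_reals all_analysis.

Set Implicit Arguments.
Unset Strict Implicit.
Unset Printing Implicit Defensive.

Import Order.TTheory GRing.Theory Num.Theory.
Import numFieldNormedType.Exports.

Local Open Scope classical_set_scope.
Local Open Scope ring_scope.

Notation lpoint := (nat * nat)%type.

Definition origin : lpoint := (0%N, 0%N).

(* A polygonal line is the sequence of its vertices, in order of traversal; an
   edge is the pair (left endpoint, right endpoint) of consecutive vertices. *)
Definition edges (G : seq lpoint) : seq (lpoint * lpoint) := zip G (behead G).

(* The principal argument, in ]-pi, pi], of the nonzero vector e.2 - e.1. *)
Definition inclination (R : realType) (e : lpoint * lpoint) : R :=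
  let x := e.2.1%:R - e.1.1%:R in
  let y := e.2.2%:R - e.1.2%:R in
  let t := acos (x / Num.sqrt (x ^+ 2 + y ^+ 2)) in
  if 0 <= y then t else - t.

(* Edges are nondegenerate and strictly turning, so distinct vertex sequences
   are distinct paths.  The line [:: origin] without edges is allowed. *)
Definition convex_lattice_line (R : realType) (G : seq lpoint) : Prop :=
  [/\ ohead G = Some origin,
      {in edges G, forall e, e.1 != e.2},
      {in edges G, forall e, 0 <= inclination R e <= pi / 2} &
      sorted <%R [seq inclination R e | e <- edges G]].

(* The dependence on R comes only from the type in which angles are measured. *)
Definition Pi (R : realType) (n : lpoint) : set (seq lpoint) :=
  [set G | convex_lattice_line R G /\ last origin G = n].

Lemma inclination_mono (R : realType) (e : lpoint * lpoint) :
  e.1 != e.2 -> 0 <= inclination R e <= pi / 2 ->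
  (e.1.1 <= e.2.1)%N && (e.1.2 <= e.2.2)%N.
Proof.
case: e => [[a b] [c d]] /= ne; rewrite /inclination /=.
set x := c%:R - a%:R; set y := d%:R - b%:R.
set s := Num.sqrt _.
have xy0 : 0 < x ^+ 2 + y ^+ 2.
  rewrite lt0r addr_ge0 ?sqr_ge0// andbT paddr_eq0 ?sqr_ge0// !sqrf_eq0.
  rewrite !subr_eq0 !eqr_nat; apply: contra ne => /andP[/eqP -> /eqP ->].
  exact: eqxx.
have s0 : 0 < s by rewrite sqrtr_gt0.
have s2 : s ^+ 2 = x ^+ 2 + y ^+ 2 by rewrite sqr_sqrtr// ltW.
have xs : `|x| <= s by rewrite -sqrtr_sqr ler_sqrt ?lerDl ?sqr_ge0 ?ltW.
have xsB : -1 <= x / s <= 1.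
  by rewrite -ler_norml normrM normfV (gtr0_norm s0) ler_pdivrMr// mul1r.
have cosE : cos (acos (x / s)) = x / s by rewrite acosK// in_itv.
have -> : (a <= c)%N = (0 <= x) by rewrite subr_ge0 ler_nat.
have -> : (b <= d)%N = (0 <= y) by rewrite subr_ge0 ler_nat.
case: ifPn => [y0 /andP[t0 t1]|yN /andP[t0 t1]].
  rewrite andbT; have : 0 <= cos (acos (x / s)).
    apply: cos_ge0_pihalf; rewrite t1 andbT.
    by apply: le_trans t0; rewrite oppr_le0 divr_ge0 ?pi_ge0.
  by rewrite cosE pmulr_lge0 ?invr_gt0.
have t00 : acos (x / s) = 0.
  by apply/eqP; rewrite eq_le acos_ge0// andbT -oppr_ge0.
have xE : x = s.
  by move: cosE; rewrite t00 cos0 => /esym/(canRL (mulfVK _))->;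
    rewrite ?mul1r// gt_eqF.
have /eqP : y ^+ 2 = 0 by apply: (addrI (x ^+ 2)); rewrite addr0 -s2 xE.
by rewrite sqrf_eq0 => /eqP y0; rewrite y0 lexx in yN.
Qed.

Lemma finite_Pi (R : realType) (n : lpoint) : finite_set (Pi R n).
Proof.
have box (p : lpoint) (G : seq lpoint) :
    {in edges (p :: G), forall e, e.1 != e.2} ->
    {in edges (p :: G), forall e, (e.1.1 <= e.2.1)%N && (e.1.2 <= e.2.2)%N} ->
    (size G + p.1 + p.2 <= (last p G).1 + (last p G).2)%N /\
    {in p :: G, forall q, (q.1 <= (last p G).1)%N && (q.2 <= (last p G).2)%N}.
  elim: G p => [|q G IH] p ne mono.
    by split=> // q; rewrite inE => /eqP->; rewrite !leqnn.
  have [|e eG|IH1 IH2] := IH q.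
  - by move=> e eG; apply: ne; rewrite inE eG orbT.
  - by apply: mono; rewrite inE eG orbT.
  have pq := mono (p, q) (mem_head _ _); have npq := ne (p, q) (mem_head _ _).
  have lq := IH2 q (mem_head _ _).
  split=> [|z].
    move: pq npq IH1 => /=; case: p {ne mono} => a b; case: q {IH IH2 lq} => c d.
    rewrite /= xpair_eqE negb_and; lia.
  rewrite inE => /predU1P[->|/IH2//].
  by move: pq lq => /= /andP[a b] /andP[c d]; rewrite (leq_trans a c) (leq_trans b d).
pose T : finType := ('I_n.1.+1 * 'I_n.2.+1)%type.
pose m := (n.1 + n.2).+1.
pose f (t : T) : lpoint := (nat_of_ord t.1, nat_of_ord t.2).
pose g (s : {bseq m of T}) : seq lpoint := map f s.
apply: (@sub_finite_set _ _ (g @` [set: {bseq m of T}])); last first.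
  exact/finite_image/finite_finset.
move=> [|p G] [[]]//= [->] ne rg _ nE.
have [|sz le_n] := box origin G ne.
  by move=> e eG; apply: (@inclination_mono R); [exact: ne|exact: rg].
rewrite nE /= !addn0 in sz le_n.
pose h (q : lpoint) : T := (inord q.1, inord q.2).
have szb : (size (map h (origin :: G)) <= m)%N by rewrite size_map.
exists (Bseq szb) => //; rewrite /g [LHS]/= -map_comp -[RHS]map_id.
rewrite -[LHS]/(map (f \o h) (origin :: G)); apply/eq_in_map => q /le_n/andP[q1 q2].
by case: q q1 q2 => a b /= a1 b1; rewrite /f /h /= !inordK.
Qed.

(* Points of a segment between points of the quadrant lie in the quadrant, so
   lattice points may be taken in nat * nat. *)
Definition on_segment (R : realType) (e : lpoint * lpoint) (z : lpoint) : Prop :=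
  exists t : R, [/\ 0 <= t <= 1,
    z.1%:R = (1 - t) * e.1.1%:R + t * e.2.1%:R &
    z.2%:R = (1 - t) * e.1.2%:R + t * e.2.2%:R].

Lemma finite_on_segment (R : realType) (e : lpoint * lpoint) :
  finite_set [set z | on_segment R e z].
Proof.
case: e => [[a b] [c d]].
pose f (t : 'I_(a + c).+1 * 'I_(b + d).+1) : lpoint :=
  (nat_of_ord t.1, nat_of_ord t.2).
apply: (@sub_finite_set _ _ (f @` setT)); last exact/finite_image/finite_finset.
have le_add (t : R) (u v w : nat) : 0 <= t <= 1 ->
    w%:R = (1 - t) * u%:R + t * v%:R -> (w < (u + v).+1)%N.
  move=> /andP[t0 t1] wE; rewrite ltnS -(ler_nat R) wE natrD.
  by rewrite lerD ?ler_piMl// lerBlDr lerDl.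
move=> [x y] [t [/= t01 /(le_add _ _ _ _ t01) xb /(le_add _ _ _ _ t01) yb]].
by exists (Ordinal xb, Ordinal yb).
Qed.

Definition edge_count (R : realType) (e : lpoint * lpoint) : nat :=
  #|` fset_set [set z | on_segment R e z /\ z <> e.1]|%fset.

Definition bcoef (R : realType) (r : R) (k : nat) : R :=
  (\prod_(i < k) (r + i%:R)) / (k`!)%:R.

Definition bweight (R : realType) (r : R) (G : seq lpoint) : R :=
  \prod_(e <- edges G) bcoef r (edge_count R e).

Definition Pmass (R : realType) (r : R) (n : lpoint) (G : seq lpoint) : R :=
  bweight r G / \sum_(H \in Pi R n) bweight r H.

Definition Pmeas (R : realType) (r : R) (n : lpoint) (A : set (seq lpoint)) : R :=
  \sum_(G \in A) Pmass r n G.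

Definition tv_dist (R : realType) (T : Type) (D : set T) (P Q : set T -> R) : R :=
  sup [set `|P A - Q A| | A in [set A | A `<=` D]].

(* f n tends to l as n = (n1, n2) has n1, n2 -> oo with n1 / n2 bounded away
   from 0 and oo: convergence along each region c <= n1 / n2 <= C. *)
Definition lim_balanced (R : realType) (f : lpoint -> R) (l : R) : Prop :=
  forall c C : R, 0 < c ->
    f @ within [set n : lpoint | c <= n.1%:R / n.2%:R <= C]
               (filter_prod \oo \oo) --> l.

Definition asymptotically_singular (R : realType) (D : lpoint -> set (seq lpoint))
    (P Q : lpoint -> set (seq lpoint) -> R) : Prop :=
  lim_balanced (fun n => tv_dist (D n) (P n) (Q n)) 1.

(* Main.v *)
Require Import Defs.
From HB Require Import structures.
From mathcomp Require Import all_boot all_order all_algebra.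
From mathcomp Require Import zify ring lra.
From mathcomp Require Import all_classical all_reals all_analysis.
Import Order.TTheory GRing.Theory Num.Theory.
Import numFieldNormedType.Exports.
Set Implicit Arguments.
Unset Strict Implicit.

(** A convex lattice line is determined by how often it uses each primitive
direction, so the lines ending at n correspond to functions nu from primitive
vectors to multiplicities (configurations) such that the multiples nu x times x
add up to n, the weight of a line being the product of the bcoef r (nu x).  Under the
parameter 1 all configurations have the same weight.  It suffices that the
Hellinger affinity of the two measures, the sum of the sqrt (p * q), tends to
0, since the total variation distance is at least 1 minus the affinity.

The affinity is split over small exchange classes.  Three primitive vectors
x, y and z = x + y allow one x and one y to be traded for one z, with the
rest of the configuration fixed; the class reached by such trades is an
interval of values c of the multiplicity of z.  On it the uniform measure is
flat, while the weights of parameter r are products of bcoef r (A - c),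
bcoef r (B - c) and bcoef r c.  The sequence bcoef r is log-concave for
1 < r and log-convex for r < 1, with a quantitative gap on points
s, s + h, s + 2 h for s < h, so the class with at least three points has
affinity at most a constant rho < 1 that depends on r only
(group_spread).  With M disjoint triples the affinity is at most rho ^+ M, up
to the square root of the probability that some class is too short
(confs_affinity).

A class is long enough when z has multiplicity at least 2, and for the uniform
measure the probability of this is a ratio of two cardinals, at endpoints
n - 2 z and n.  Going from n to n - 2 z by unit
steps, one needs that almost every configuration uses the horizontal vector
e = (1, 0), and symmetrically (0, 1).  If e is absent, replace one occurrence
of a vector y = (i, j) with 0 < i by i - 1 copies of e and one copy of (1, j).
The new configuration has the same endpoint; it determines i, and j lies among the
indices of the vectors (1, j) that it uses, of which there are O(sqrt N), as
their second coordinates have sum at most N.  A typical configuration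
offers far more than sqrt N choices of y: the configurations with few distinct
vectors are negligible, because the subsets of the primitive vectors of a box
of side about N ^ (1/3) already give exponentially many configurations
(confs_lower_bound).  So the configurations without e are negligible
(axis_ratio), and affinity_vanishes follows. *)

(** * Flatness of sums of square roots *)

Local Open Scope ring_scope.

Lemma cauchy_add (R : realFieldType) (X C Q Y c q : R) :
  0 <= C -> 0 <= Q -> 0 <= c -> 0 <= q ->
  X ^+ 2 <= C * Q -> Y ^+ 2 <= c * q ->
  (X + Y) ^+ 2 <= (C + c) * (Q + q).
Proof.
move=> C0 Q0 c0 q0 hX hY.
(* Twice the geometric mean of C * q and Q * c is at most their sum. *)
have cross : 2 * (X * Y) <= C * q + Q * c.
  apply: (le_trans (ler_norm _)).
  rewrite -(ler_pXn2r (_ : (0 < 2)%N)) ?nnegrE ?normr_ge0 ?addr_ge0 ?mulr_ge0 //.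
  rewrite real_normK ?num_real //.
  have h1 : X ^+ 2 * Y ^+ 2 <= (C * Q) * (c * q).
    by rewrite ler_pM ?sqr_ge0.
  have := sqr_ge0 (C * q - Q * c); nra.
by rewrite sqrrD; lra.
Qed.

(** Weighted Cauchy-Schwarz, in the form that glues local bounds on the squares
a j ^+ 2 into a bound on the square of the sum; it also compares a sum of
square roots with the square root of a sum. *)
Lemma cauchy_sum (R : realFieldType) (J : Type) (s : seq J) (P : pred J)
    (a c q : J -> R) :
  (forall j, P j -> 0 <= c j) -> (forall j, P j -> 0 <= q j) ->
  (forall j, P j -> a j ^+ 2 <= c j * q j) ->
  (\sum_(j <- s | P j) a j) ^+ 2
    <= (\sum_(j <- s | P j) c j) * (\sum_(j <- s | P j) q j).
Proof.
move=> c0 q0 acq; elim: s => [|j s IH]; first by rewrite !big_nil expr0n mul0r.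
rewrite !big_cons; case: ifPn => // Pj.
by apply: cauchy_add => //; rewrite ?sumr_ge0 ?c0 ?q0 ?acq.
Qed.

(** A triple that is far from geometric loses a fixed fraction in Cauchy-Schwarz.
The defect 3 * Q - (x + y + z) ^+ 2 is the sum D of the squared differences.  If
y ^+ 2 is a fair share of the sum of squares Q, then y ^+ 2 - x * z is a
combination of differences, so its square is at most Q * D; otherwise the larger
of x, z is at least twice y and D is large for that reason. *)
Lemma triple_gap (R : realFieldType) (t x y z : R) :
  0 < t <= 1 -> 0 <= x -> 0 <= y -> 0 <= z ->
  t * y ^+ 2 <= `|y ^+ 2 - x * z| ->
  (x + y + z) ^+ 2
    <= (3 - t ^+ 2 / 144) * (x ^+ 2 + y ^+ 2 + z ^+ 2).
Proof.
move=> /andP[t0 t1] x0 y0 z0 hyp.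
set Q := x ^+ 2 + y ^+ 2 + z ^+ 2.
set D := (x - y) ^+ 2 + (y - z) ^+ 2 + (x - z) ^+ 2.
have DE : (x + y + z) ^+ 2 = 3 * Q - D by rewrite /Q /D; ring.
suff : t ^+ 2 / 144 * Q <= D by rewrite DE mulrBl; lra.
have Q0 : 0 <= Q by rewrite /Q !addr_ge0 ?sqr_ge0.
have D0 : 0 <= D by rewrite /D !addr_ge0 ?sqr_ge0.
have t2 : t ^+ 2 <= 1 by rewrite exprn_ile1 // ltW.
have t20 : 0 <= t ^+ 2 by exact: sqr_ge0.
have [hy|hy] := lerP (Q / 12) (y ^+ 2).
  have hD : (y ^+ 2 - x * z) ^+ 2 <= Q * D.
    have -> : y ^+ 2 - x * z = y * (y - x) + x * (y - z) by ring.
    rewrite -subr_ge0.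
    have -> : Q * D - (y * (y - x) + x * (y - z)) ^+ 2 =
       (y * (y - z) - x * (y - x)) ^+ 2 + z ^+ 2 * D
       + (x ^+ 2 + y ^+ 2) * (x - z) ^+ 2 by rewrite /Q /D; ring.
    by apply: addr_ge0; [apply: addr_ge0|]; rewrite ?sqr_ge0 // mulr_ge0 ?addr_ge0 ?sqr_ge0.
  have h2 : (t * (Q / 12)) ^+ 2 <= Q * D.
    apply: le_trans hD; rewrite -[leRHS]real_normK ?num_real //.
    have tQ0 : 0 <= t * (Q / 12) by apply: mulr_ge0; [exact: ltW | rewrite divr_ge0].
    rewrite ler_pXn2r ?nnegrE //.
    by apply: (le_trans _ hyp); rewrite ler_wpM2l ?(ltW t0).
  have [Q_gt0|] := ltrP 0 Q; last first.
    by move=> Qle; have -> : Q = 0 by [apply/eqP; rewrite eq_le Qle Q0]; rewrite mulr0.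
  rewrite -(ler_pM2l Q_gt0); apply: le_trans h2.
  by rewrite le_eqVlt; apply/orP; left; apply/eqP; field.
have h4 : t ^+ 2 / 144 * Q <= Q / 144.
  by rewrite mulrAC ler_pM2r ?invr_gt0 // ler_piMl.
apply: (le_trans h4).
have [xz|xz] := lerP (z ^+ 2) (x ^+ 2).
  have hx : 11 / 24 * Q <= x ^+ 2 by rewrite /Q in hy *; lra.
  have xy : 2 * y <= x.
    rewrite -(ler_pXn2r (_ : (0 < 2)%N)) ?nnegrE ?mulr_ge0 //.
    by rewrite exprMn; lra.
  have : x ^+ 2 / 4 <= (x - y) ^+ 2 by nra.
  have := sqr_ge0 (y - z); have := sqr_ge0 (x - z); rewrite /D; lra.
have hx : 11 / 24 * Q <= z ^+ 2 by rewrite /Q in hy *; lra.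
have xy : 2 * y <= z.
  rewrite -(ler_pXn2r (_ : (0 < 2)%N)) ?nnegrE ?mulr_ge0 //.
  by rewrite exprMn; lra.
have : z ^+ 2 / 4 <= (y - z) ^+ 2 by nra.
have := sqr_ge0 (x - y); have := sqr_ge0 (x - z); rewrite /D; lra.
Qed.

(** Pairing position s with s + h and s + 2 h covers the first 3 h positions
once each. *)
Lemma sum_triples (R : nmodType) (g : nat -> R) (h : nat) :
  \sum_(0 <= c < h + h + h) g c
    = \sum_(0 <= s < h) (g s + g (s + h)%N + g (s + (h + h))%N).
Proof.
rewrite (@big_cat_nat _ _ _ (h + h)) ?leq_addr //=.
rewrite (@big_cat_nat _ _ _ h 0 (h + h)) ?leq_addr //= !big_split /=.
congr (_ + _ + _).
  by rewrite -{1}[h]add0n big_addn addnK.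
by rewrite -{1}[(h + h)%N]add0n big_addn addnC addnK.
Qed.

(** With h = L %/ 3 the triples leave out at most two positions, so they cover at
least three fifths of the L positions; the gain of eta per triple becomes eta / 5. *)
Lemma spread_of_triples (R : realFieldType) (eta : R) (g : nat -> R) (L : nat) :
  0 <= eta <= 3 -> (3 <= L)%N ->
  (forall s h, (s < h)%N -> (s + (h + h) < L)%N ->
     (g s + g (s + h)%N + g (s + (h + h))%N) ^+ 2
       <= (3 - eta) * (g s ^+ 2 + g (s + h)%N ^+ 2 + g (s + (h + h))%N ^+ 2)) ->
  (\sum_(0 <= c < L) g c) ^+ 2
    <= (1 - eta / 5) * L%:R * \sum_(0 <= c < L) g c ^+ 2.
Proof.
move=> /andP[eta0 eta3] L3 htri; set h := (L %/ 3)%N.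
have hL : (h + h + h <= L)%N by rewrite /h; lia.
rewrite (@big_cat_nat _ _ _ (h + h + h)) //=.
rewrite (@big_cat_nat _ _ _ (h + h + h) 0 L) //= !sum_triples.
set Q1 := (X in _ <= _ * (X + _)); set Q2 := (X in _ <= _ * (_ + X)).
have Q1_ge0 : 0 <= Q1 by apply: sumr_ge0 => s _; rewrite !addr_ge0 ?sqr_ge0.
have Q2_ge0 : 0 <= Q2 by apply: sumr_ge0 => s _; rewrite sqr_ge0.
apply: (@le_trans _ _ (((3 - eta) * h%:R + (L - (h + h + h))%:R) * (Q1 + Q2))).
  apply: cauchy_add => //; first by rewrite mulr_ge0 // subr_ge0.
    have -> : (3 - eta) * h%:R = \sum_(0 <= s < h) (3 - eta).
      by rewrite sumr_const_nat subn0 mulr_natr.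
    rewrite /Q1 !big_nat.
    apply: cauchy_sum => s /andP[_ sh]; rewrite ?subr_ge0 //.
      by rewrite !addr_ge0 ?sqr_ge0.
    by apply: htri => //; lia.
  have -> : (L - (h + h + h))%:R = \sum_((h + h + h)%N <= s < L) 1 :> R.
    by rewrite sumr_const_nat.
  by apply: cauchy_sum => s _; rewrite ?sqr_ge0 ?mul1r ?ler01.
rewrite ler_wpM2r ?addr_ge0 // natrB // !natrD.
have : (L%:R <= 5 * h%:R :> R) by rewrite -natrM ler_nat /h; lia.
move: eta0; clear; nra.
Qed.
(** * Log-concavity of the edge weights *)

Section BCoef.
Variables (R : realType) (r : R).
Hypothesis r_gt0 : 0 < r.

Lemma bcoef0 : bcoef r 0 = 1.
Proof. by rewrite /bcoef big_ord0 fact0 divr1. Qed.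

Lemma bcoefS k : bcoef r k.+1 = bcoef r k * ((r + k%:R) / k.+1%:R).
Proof.
rewrite /bcoef big_ord_recr /= factS natrM; field.
by rewrite !pnatr_eq0 /= -lt0n fact_gt0 nat1r pnatr_eq0.
Qed.

Lemma bcoef_gt0 k : 0 < bcoef r k.
Proof.
elim: k => [|k IH]; first by rewrite bcoef0.
by rewrite bcoefS mulr_gt0 // divr_gt0 ?ltr_wpDr.
Qed.

(** The step ratio of bcoef r at s + h + i divided by the step ratio at s + i: its
position relative to 1 decides between log-concavity and log-convexity. *)
Let quot (s h i : nat) : R :=
  ((r + (s + h + i)%:R) * (s + i).+1%:R)
    / ((s + h + i).+1%:R * (r + (s + i)%:R)).

Lemma bcoef_shift s h i :
  bcoef r (s + h + i) * bcoef r s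
    = bcoef r (s + h) * bcoef r (s + i) * \prod_(0 <= j < i) quot s h j.
Proof.
elim: i => [|i IH]; first by rewrite !addn0 big_geq // mulr1.
rewrite big_nat_recr //= mulrA.
have -> : bcoef r (s + h + i.+1) * bcoef r s =
   bcoef r (s + h + i) * bcoef r s * ((r + (s + h + i)%:R) / (s + h + i).+1%:R).
  by rewrite addnS bcoefS; ring.
rewrite IH addnS bcoefS /quot.
have h1 : r + (s + i)%:R != 0 by rewrite gt_eqF // ltr_wpDr.
have h2 : (s + h + i).+1%:R != 0 :> R by rewrite pnatr_eq0.
have h3 : (s + i).+1%:R != 0 :> R by rewrite pnatr_eq0.
move: h1 h2 h3; generalize (r + (s + i)%:R) => u; move: (s + h + i).+1%:R => v.
move: (s + i).+1%:R => w h1 h2 h3; set p := \prod_(_ <= _ < _) _.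
by field; rewrite h1 h2 h3.
Qed.

(** When s < h, each of the h factors differs from 1 by at least a constant times
1 / h, always on the same side, so the product stays away from 1 uniformly in h. *)
Lemma bcoef_shift2 s h :
  bcoef r s * bcoef r (s + (h + h))
    = bcoef r (s + h) ^+ 2 * \prod_(0 <= j < h) quot s h j.
Proof. by rewrite mulrC addnA bcoef_shift expr2. Qed.

Lemma quot_gt0 s h i : 0 < quot s h i.
Proof. by rewrite /quot divr_gt0 // mulr_gt0 // ltr_wpDr. Qed.

(** From (1 - x) ^+ h * (1 + x) ^+ h <= 1 and the Bernoulli inequality. *)
Lemma one_sub_pow (g : R) h : 0 <= g -> g <= h%:R -> (0 < h)%N ->
  (1 - g / h%:R) ^+ h <= (1 + g)^-1.
Proof.
move=> g0 gh h0; set x := g / h%:R.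
have hR : 0 < h%:R :> R by rewrite ltr0n.
have x0 : 0 <= x by rewrite divr_ge0 // ltW.
have x1 : x <= 1 by rewrite ler_pdivrMr // mul1r.
have -> : g = x * h%:R by rewrite /x divfK // gt_eqF.
rewrite -[leRHS]mul1r ler_pdivlMr; last first.
  by rewrite ltr_wpDr // mulr_ge0 // ltW.
have bern n : 1 + x * n%:R <= (1 + x) ^+ n.
  elim: n => [|n IH]; first by rewrite mulr0 addr0 expr0.
  rewrite exprSr -natr1; apply: (@le_trans _ _ ((1 + x * n%:R) * (1 + x))).
    have : 0 <= x * n%:R * x by rewrite !mulr_ge0.
    by nra.
  by rewrite ler_wpM2r // addr_ge0.
apply: (@le_trans _ _ ((1 - x) ^+ h * (1 + x) ^+ h)).
  by rewrite ler_wpM2l // exprn_ge0 // subr_ge0.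
rewrite -exprMn exprn_ile1 //; first by nra.
by have := sqr_ge0 x; nra.
Qed.

Lemma prod_le_pow (g : R) (F : nat -> R) h : 0 <= g -> g <= 1 -> (0 < h)%N ->
  (forall j, (j < h)%N -> 0 <= F j) ->
  (forall j, (j < h)%N -> F j <= 1 - g / h%:R) ->
  \prod_(0 <= j < h) F j <= (1 + g)^-1.
Proof.
move=> g0 g1 h0 F0 F1; have hR : 1 <= h%:R :> R by rewrite ler1n.
apply: (le_trans _ (one_sub_pow g0 (le_trans g1 hR) h0)).
rewrite -[X in (_ - _) ^+ X](subn0 h) -prodr_const_nat !big_nat.
by apply: ler_prod => j /andP[_ jh]; rewrite F0 // F1.
Qed.

Lemma quot_le s h j : 1 < r -> (s < h)%N -> (j < h)%N ->
  quot s h j <= 1 - ((r - 1) / (3 * (r + 1))) / h%:R.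
Proof.
move=> r1 sh jh; rewrite /quot.
have h0 : 1 <= h%:R :> R by rewrite ler1n; lia.
set Y : R := (s + j).+1%:R; set X : R := (s + h + j).+1%:R.
have XY : X = Y + h%:R by rewrite /X /Y -natrD; congr _%:R; lia.
have -> : r + (s + h + j)%:R = X + (r - 1) by rewrite /X -natr1; ring.
have -> : r + (s + j)%:R = Y + (r - 1) by rewrite /Y -natr1; ring.
have Y1 : 1 <= Y by rewrite /Y ler1n.
have Y2 : Y <= 2 * h%:R by rewrite /Y -natrM ler_nat; lia.
clearbody X Y; move: (h%:R : R) h0 XY Y2 => {sh jh}H h0 XY Y2.
have p0 : 0 < r - 1 by rewrite subr_gt0.
have X0 : 0 < X by lra.
have Z0 : 0 < Y + (r - 1) by lra.
rewrite -subr_ge0.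
have -> : 1 - (r - 1) / (3 * (r + 1)) / H - (X + (r - 1)) * Y / (X * (Y + (r - 1)))
  = (r - 1) * (H / (X * (Y + (r - 1))) - (3 * (r + 1) * H)^-1).
  rewrite XY; field; rewrite -XY; do ![apply/andP; split]; rewrite gt_eqF //; lra.
rewrite pmulr_rge0 // subr_ge0 -[leLHS]mul1r ler_pdivrMr; last by nra.
rewrite mulrAC ler_pdivlMr ?mulr_gt0 // mul1r XY.
apply: (@le_trans _ _ ((3 * H) * ((r + 1) * H))); last by nra.
by apply: ler_pM; nra.
Qed.

Lemma quot_inv_le s h j : r < 1 -> (s < h)%N -> (j < h)%N ->
  (quot s h j)^-1 <= 1 - ((1 - r) / 6) / h%:R.
Proof.
move=> r1 sh jh; rewrite /quot invf_div.
have h0 : 1 <= h%:R :> R by rewrite ler1n; lia.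
set Y : R := (s + j).+1%:R; set X : R := (s + h + j).+1%:R.
have XY : X = Y + h%:R by rewrite /X /Y -natrD; congr _%:R; lia.
have -> : r + (s + h + j)%:R = X - (1 - r) by rewrite /X -natr1; ring.
have -> : r + (s + j)%:R = Y - (1 - r) by rewrite /Y -natr1; ring.
have Y1 : 1 <= Y by rewrite /Y ler1n.
have Y2 : Y <= 2 * h%:R by rewrite /Y -natrM ler_nat; lia.
clearbody X Y; move: (h%:R : R) h0 XY Y2 => {sh jh}H h0 XY Y2.
have p0 : 0 < 1 - r by rewrite subr_gt0.
have r0 := r_gt0; have X0 : 0 < X - (1 - r) by rewrite XY; lra.
rewrite -subr_ge0.
have -> : 1 - (1 - r) / 6 / H - X * (Y - (1 - r)) / ((X - (1 - r)) * Y)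
  = (1 - r) * (H / ((X - (1 - r)) * Y) - (6 * H)^-1).
  rewrite XY; field; rewrite -XY; do ![apply/andP; split]; rewrite gt_eqF //; lra.
rewrite pmulr_rge0 // subr_ge0 -[leLHS]mul1r ler_pdivrMr; last by nra.
rewrite mulrAC ler_pdivlMr ?mulr_gt0 //; last by lra.
rewrite mul1r mulrC; apply: (@le_trans _ _ ((2 * H) * (3 * H))); last by nra.
by apply: ler_pM; lra.
Qed.

Lemma quot_le1 s h j : 1 < r -> quot s h j <= 1.
Proof.
move=> r1; rewrite /quot ler_pdivrMr ?mul1r; last by rewrite mulr_gt0 // ltr_wpDr.
have e1 : (s + h + j).+1%:R = h%:R + (s + j).+1%:R :> R
   by rewrite -natrD; congr _%:R; lia.
have e2 : (s + h + j)%:R = h%:R + (s + j)%:R :> R by rewrite -natrD; congr _%:R; lia.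
rewrite e1 e2 -!natr1; have : 0 <= h%:R :> R by []. nra.
Qed.

Lemma quot_ge1 s h j : r < 1 -> 1 <= quot s h j.
Proof.
move=> r1; rewrite /quot ler_pdivlMr ?mul1r; last by rewrite mulr_gt0 // ltr_wpDr.
have e1 : (s + h + j).+1%:R = h%:R + (s + j).+1%:R :> R
   by rewrite -natrD; congr _%:R; lia.
have e2 : (s + h + j)%:R = h%:R + (s + j)%:R :> R by rewrite -natrD; congr _%:R; lia.
rewrite e1 e2 -!natr1; have : 0 <= h%:R :> R by []. nra.
Qed.

Lemma bcoef_logconcave s h : 1 < r ->
  bcoef r s * bcoef r (s + (h + h)) <= bcoef r (s + h) ^+ 2.
Proof.
move=> r1; rewrite bcoef_shift2 ler_piMr ?sqr_ge0 //.
by apply: prodr_ile1 => j _; rewrite ltW ?quot_gt0 ?quot_le1.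
Qed.

Lemma bcoef_logconvex s h : r < 1 ->
  bcoef r (s + h) ^+ 2 <= bcoef r s * bcoef r (s + (h + h)).
Proof.
move=> r1; rewrite bcoef_shift2 ler_peMr ?sqr_ge0 //.
elim/big_rec: _ => // j x _ x1.
by rewrite -[1]mulr1 ler_pM ?ler01 // quot_ge1.
Qed.

Lemma bcoef_concave_gap : 1 < r -> exists2 k : R, 0 < k < 1 &
  forall s h, (s < h)%N ->
    bcoef r s * bcoef r (s + (h + h)) <= k * bcoef r (s + h) ^+ 2.
Proof.
move=> r1; pose g : R := (r - 1) / (3 * (r + 1)).
have g0 : 0 < g by rewrite /g divr_gt0 //; lra.
have g1 : g <= 1 by rewrite /g ler_pdivrMr; lra.
exists (1 + g)^-1 => [|s h sh].
  by rewrite invr_gt0 invf_lt1 addr_gt0 ?ltrDl ?g0.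
rewrite bcoef_shift2 mulrC ler_wpM2r ?sqr_ge0 //.
apply: prod_le_pow; rewrite ?(ltW g0) //; first by lia.
  by move=> j _; rewrite ltW ?quot_gt0.
by move=> j jh; exact: quot_le.
Qed.

Lemma bcoef_convex_gap : r < 1 -> exists2 k : R, 0 < k < 1 &
  forall s h, (s < h)%N ->
    bcoef r (s + h) ^+ 2 <= k * (bcoef r s * bcoef r (s + (h + h))).
Proof.
move=> r1; have r0 := r_gt0; pose g : R := (1 - r) / 6.
have g0 : 0 < g by rewrite /g; lra.
have g1 : g <= 1 by rewrite /g; lra.
exists (1 + g)^-1 => [|s h sh].
  by rewrite invr_gt0 invf_lt1 addr_gt0 ?ltrDl ?g0.
rewrite bcoef_shift2 mulrCA ler_peMr ?sqr_ge0 //.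
have P0 : 0 < \prod_(0 <= j < h) quot s h j by apply: prodr_gt0 => j _; exact: quot_gt0.
rewrite -ler_pdivrMr // mul1r -prodfV.
apply: prod_le_pow; rewrite ?(ltW g0) //; first by lia.
  by move=> j _; rewrite invr_ge0 ltW ?quot_gt0.
by move=> j jh; exact: quot_inv_le.
Qed.

End BCoef.
(** Transfers a multiplicative gap of the weights to their square roots, in the
form required by triple_gap. *)
Lemma sqrt_gap (R : rcfType) (k u v w : R) :
  0 < k < 1 -> 0 <= u -> 0 <= v -> 0 <= w ->
  u * w <= k * v ^+ 2 \/ v ^+ 2 <= k * (u * w) ->
  (1 - Num.sqrt k) * Num.sqrt v ^+ 2
    <= `|Num.sqrt v ^+ 2 - Num.sqrt u * Num.sqrt w|.
Proof.
move=> /andP[k0 k1] u0 v0 w0.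
rewrite -sqrtrM // sqr_sqrtr //.
have q0 : 0 <= Num.sqrt k by exact: sqrtr_ge0.
have q1 : Num.sqrt k <= 1 by rewrite -sqrtr1 ler_sqrt // ltW.
have uw0 : 0 <= u * w by rewrite mulr_ge0.
have vE : v = Num.sqrt (v ^+ 2) by rewrite sqrtr_sqr ger0_norm.
case=> [h|h].
  have : Num.sqrt (u * w) <= Num.sqrt k * v.
    by rewrite vE -sqrtrM ?(ltW k0) // ler_sqrt // mulr_ge0 ?sqr_ge0 ?(ltW k0).
  by move=> h1; rewrite ler_normr; apply/orP; left; lra.
have h1 : v <= Num.sqrt k * Num.sqrt (u * w).
  by rewrite {1}vE -sqrtrM ?(ltW k0) // ler_sqrt // mulr_ge0 ?(ltW k0).
have s0 : 0 <= Num.sqrt (u * w) by exact: sqrtr_ge0.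
set X := Num.sqrt (u * w) in h1 s0 *; set q := Num.sqrt k in h1 q0 q1 *.
have h2 : v <= X by rewrite (le_trans h1) // ler_piMl.
have h3 : (1 - q) * v <= (1 - q) * X by rewrite ler_wpM2l // subr_ge0.
by rewrite ler_normr; apply/orP; right; lra.
Qed.

(** The weight of the three multiplicities A - c, B - c, c of x, y, x + y in an
exchange class with invariants A and B. *)
Definition group_weight (R : realType) (r : R) (A B c : nat) : R :=
  bcoef r (A - c) * bcoef r (B - c) * bcoef r c.

Lemma group_weight_gt0 (R : realType) (r : R) (r_gt0 : 0 < r) A B c :
  0 < group_weight r A B c.
Proof. by apply: mulr_gt0; [apply: mulr_gt0|]; exact: bcoef_gt0. Qed.

Lemma gap_mul_le (R : realFieldType) (k a0 a1 a2 b0 b1 b2 c0 c1 c2 : R) :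
  0 <= a0 -> 0 <= a2 -> 0 <= b0 -> 0 <= b2 -> 0 <= c0 -> 0 <= c2 ->
  a0 * a2 <= a1 ^+ 2 -> b0 * b2 <= b1 ^+ 2 -> c0 * c2 <= k * c1 ^+ 2 ->
  (a2 * b2 * c0) * (a0 * b0 * c2) <= k * (a1 * b1 * c1) ^+ 2.
Proof.
move=> a00 a20 b00 b20 c00 c20 ha hb hc.
have -> : a2 * b2 * c0 * (a0 * b0 * c2) = (a0 * a2) * (b0 * b2) * (c0 * c2).
  by ring.
have -> : k * (a1 * b1 * c1) ^+ 2 = a1 ^+ 2 * b1 ^+ 2 * (k * c1 ^+ 2) by ring.
by apply: ler_pM => //; [| |apply: ler_pM => //]; rewrite ?mulr_ge0.
Qed.

Lemma gap_mul_ge (R : realFieldType) (k a0 a1 a2 b0 b1 b2 c0 c1 c2 : R) :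
  a1 ^+ 2 <= a0 * a2 -> b1 ^+ 2 <= b0 * b2 -> c1 ^+ 2 <= k * (c0 * c2) ->
  (a1 * b1 * c1) ^+ 2 <= k * ((a2 * b2 * c0) * (a0 * b0 * c2)).
Proof.
move=> ha hb hc; rewrite !exprMn.
have -> : k * (a2 * b2 * c0 * (a0 * b0 * c2))
          = (a0 * a2) * (b0 * b2) * (k * (c0 * c2)) by ring.
by apply: ler_pM => //; [| |apply: ler_pM => //]; rewrite ?sqr_ge0 // mulr_ge0 ?sqr_ge0.
Qed.

(** The factors with A - c and B - c are log-concave (or log-convex) in the same
sense as bcoef r c, so they can only widen the gap provided by the last factor. *)
Lemma group_weight_gap (R : realType) (r : R) : 0 < r -> r != 1 ->
  exists2 k : R, 0 < k < 1 & forall A B s h, (s < h)%N ->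
    (s + (h + h) <= minn A B)%N ->
    let w := group_weight r A B in
    w s * w (s + (h + h))%N <= k * w (s + h)%N ^+ 2 \/
    w (s + h)%N ^+ 2 <= k * (w s * w (s + (h + h))%N).
Proof.
move=> r0; have bp n := ltW (bcoef_gt0 r0 n).
have subs C s h : (s + (h + h) <= C)%N ->
    (C - s = C - (s + (h + h)) + (h + h))%N /\
    (C - (s + h) = C - (s + (h + h)) + h)%N by move=> hC; split; lia.
rewrite neq_lt => /orP[r1|r1].
  have [k k01 hk] := bcoef_convex_gap r0 r1.
  exists k => // A B s h sh; rewrite leq_min => /andP[hA hB] /=; right.
  rewrite /group_weight.
  have [-> ->] := subs _ _ _ hA; have [-> ->] := subs _ _ _ hB.
  by apply: gap_mul_ge; [exact: bcoef_logconvex..|exact: hk].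
have [k k01 hk] := bcoef_concave_gap r0 r1.
exists k => // A B s h sh; rewrite leq_min => /andP[hA hB] /=; left.
rewrite /group_weight.
have [-> ->] := subs _ _ _ hA; have [-> ->] := subs _ _ _ hB.
by apply: gap_mul_le => //; [exact: bcoef_logconcave..|exact: hk].
Qed.

(** The constant t depends on r only: it serves all exchange classes with at least
three points. *)
Lemma group_spread (R : realType) (r : R) : 0 < r -> r != 1 ->
  exists2 t : R, 0 <= t < 1 & forall A B, (2 <= minn A B)%N ->
    (\sum_(0 <= c < (minn A B).+1) Num.sqrt (group_weight r A B c)) ^+ 2
      <= t * (minn A B).+1%:R * \sum_(0 <= c < (minn A B).+1) group_weight r A B c.
Proof.
move=> r0 r1; have [k k01 hk] := group_weight_gap r0 r1.
pose q := 1 - Num.sqrt k; have /andP[k0 k1] := k01.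
have q01 : 0 < q <= 1.
  rewrite /q subr_gt0 lerBlDr lerDl sqrtr_ge0 andbT.
  by rewrite -sqrtr1 ltr_sqrt.
have /andP[q0 q1] := q01.
have q2 : 0 < q ^+ 2 <= 1 by rewrite exprn_gt0 // exprn_ile1 // ltW.
move/andP: q2 => [q20 q21].
pose eta := q ^+ 2 / 144; have eta0 : 0 < eta by rewrite /eta; lra.
have eta1 : eta <= 1 by rewrite /eta; lra.
exists (1 - eta / 5) => [|A B m2]; first by apply/andP; split; lra.
have wp c := ltW (group_weight_gt0 r0 A B c).
under [X in _ <= _ * X]eq_bigr => c _ do rewrite -[group_weight _ _ _ _]sqr_sqrtr //.
apply: spread_of_triples; rewrite ?(ltW eta0) //; first by lra.
move=> s h sh shm; apply: triple_gap; rewrite ?sqrtr_ge0 //.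
by apply: sqrt_gap; rewrite ?wp //; apply: hk.
Qed.
(** * Configurations and exchange classes *)

Section Configurations.
Local Open Scope nat_scope.
Variables (I : finType) (u v : I -> nat) (N : nat).
Hypothesis uv_gt0 : forall i, 0 < u i + v i.

(** Multiplicity functions with values at most N: finiteness of the type makes sums
and cardinals available, and the bound is automatic when both totals are at most N. *)
Definition conf := {ffun I -> 'I_N.+1}.

Definition total (w : I -> nat) (F : I -> nat) : nat := \sum_i F i * w i.

(** The configurations with endpoint (a, b). *)
Definition confs (a b : nat) : {set conf} :=
  [set nu : conf | (total u (fun i => nu i) == a) && (total v (fun i => nu i) == b)].

(** Truncates a function to a configuration; mkconfE shows that nothing is lost when
both totals are at most N, so configurations may be edited as functions to nat. *)
Definition mkconf (F : I -> nat) : conf := [ffun i => inord (F i)].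

Lemma confsP a b (nu : conf) :
  reflect (total u (fun i => nu i) = a /\ total v (fun i => nu i) = b)
          (nu \in confs a b).
Proof. by rewrite inE; apply: (iffP andP) => -[/eqP-> /eqP->]. Qed.

Lemma total_ge w F i : F i * w i <= total w F.
Proof. by rewrite /total (bigD1 i) //= leq_addr. Qed.

Lemma mkconfE F i : total u F <= N -> total v F <= N -> mkconf F i = F i :> nat.
Proof.
move=> uN vN; rewrite ffunE inordK // ltnS.
have := uv_gt0 i; rewrite addn_gt0 => /orP[ui|vi].
  by apply: leq_trans uN; apply: leq_trans (total_ge u F i); rewrite leq_pmulr.
by apply: leq_trans vN; apply: leq_trans (total_ge v F i); rewrite leq_pmulr.
Qed.

Lemma eq_total w F G : F =1 G -> total w F = total w G.
Proof. by move=> FG; apply: eq_bigr => i _; rewrite FG. Qed.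

Lemma mkconf_in F a b : total u F = a -> total v F = b -> a <= N -> b <= N ->
  mkconf F \in confs a b.
Proof.
move=> ua vb aN bN; apply/confsP; split.
  by rewrite -ua; apply: eq_total => i; rewrite mkconfE ?ua ?vb.
by rewrite -vb; apply: eq_total => i; rewrite mkconfE ?ua ?vb.
Qed.

Lemma totalD w F G : total w (fun i => F i + G i) = total w F + total w G.
Proof. by rewrite /total -big_split; apply: eq_bigr => i _; rewrite mulnDl. Qed.

Definition delta (i : I) (k : nat) (j : I) : nat := (j == i) * k.

Lemma total_delta w i k : total w (delta i k) = k * w i.
Proof.
rewrite /total (bigD1 i) //= big1 => [|j /negPf ji]; last by rewrite /delta ji !mul0n.
by rewrite /delta eqxx mul1n addn0.
Qed.

Lemma card_le_inj (T U : finType) (f : T -> U) (A : {set T}) (B : {set U}) :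
  {in A &, injective f} -> (forall x, x \in A -> f x \in B) -> #|A| <= #|B|.
Proof.
move=> finj fAB; rewrite -(card_in_imset finj); apply: subset_leq_card.
by apply/fintype.subsetP => _ /imsetP[x xA ->]; exact: fAB.
Qed.

(** Adding k copies of the direction i. *)
Lemma card_confs_sub a b i k : a <= N -> b <= N -> k * u i <= a -> k * v i <= b ->
  #|confs (a - k * u i) (b - k * v i)| = #|[set nu in confs a b | k <= nu i]|.
Proof.
move=> aN bN ka kb; apply/eqP; rewrite eqn_leq; apply/andP; split.
  have tot (nu : conf) : nu \in confs (a - k * u i) (b - k * v i) ->
      total u (fun j => nu j + delta i k j) = a /\
      total v (fun j => nu j + delta i k j) = b.
    move=> /confsP[h1 h2]; rewrite !totalD !total_delta h1 h2; lia.
  apply: (@card_le_inj _ _ (fun nu : conf => mkconf (fun j => nu j + delta i k j))).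
    move=> nu1 nu2 /tot[h1 h2] /tot[h3 h4] eq12; apply/ffunP => j; apply: val_inj.
    have := congr1 (fun f : conf => nat_of_ord (f j)) eq12.
    by rewrite !mkconfE ?h1 ?h2 ?h3 ?h4 // => /addIn.
  move=> nu /tot[h1 h2]; rewrite inE mkconf_in //=.
  by rewrite mkconfE ?h1 ?h2 // /delta eqxx mul1n leq_addl.
have tot (nu : conf) : nu \in [set nu in confs a b | k <= nu i] ->
    [/\ forall j, (nu j - delta i k j) + delta i k j = nu j,
      total u (fun j => nu j - delta i k j) = a - k * u i &
      total v (fun j => nu j - delta i k j) = b - k * v i].
  rewrite inE => /andP[/confsP[h1 h2] ki].
  have e j : (nu j - delta i k j) + delta i k j = nu j.
    by rewrite subnK // /delta; case: eqP => [->|]; rewrite ?mul1n.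
  split=> //.
    by rewrite -h1 -(eq_total u e) totalD total_delta addnK.
  by rewrite -h2 -(eq_total v e) totalD total_delta addnK.
apply: (@card_le_inj _ _ (fun nu : conf => mkconf (fun j => nu j - delta i k j))).
  move=> nu1 nu2 /tot[h1 h2 h3] /tot[h4 h5 h6] eq12; apply/ffunP => j; apply: val_inj.
  have := congr1 (fun f : conf => nat_of_ord (f j)) eq12.
  rewrite !mkconfE ?h2 ?h3 ?h5 ?h6 //; try lia.
  by move=> e; rewrite /= -h1 -h4 e.
move=> nu /tot[_ h1 h2]; apply: mkconf_in => //; lia.
Qed.

(** A triple of directions x, y, z; good_group adds that they are distinct and that
z = x + y. *)
Definition group := (I * I * I)%type.
Definition gx (g : group) : I := g.1.1.
Definition gy (g : group) : I := g.1.2.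
Definition gz (g : group) : I := g.2.
Definition gpts (g : group) : seq I := [:: gx g; gy g; gz g].

(** The exchanges preserve nu x + nu z and nu y + nu z, and these two invariants
together with nu z determine the three multiplicities. *)
Definition gA (g : group) (nu : conf) : nat := nu (gx g) + nu (gz g).
Definition gB (g : group) (nu : conf) : nat := nu (gy g) + nu (gz g).
(** The greatest multiplicity of z within the exchange class of nu, whose smallest
one is 0. *)
Definition class_max (g : group) (nu : conf) : nat := minn (gA g nu) (gB g nu).

Definition good_group (g : group) : bool :=
  [&& uniq (gpts g), u (gz g) == u (gx g) + u (gy g) &
      v (gz g) == v (gx g) + v (gy g)].

Definition movef (g : group) (nu : conf) (c : nat) (j : I) : nat :=
  if j == gz g then c else if j == gx g then gA g nu - c
  else if j == gy g then gB g nu - c else nu j.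

(** The configuration of the exchange class of nu in which z has multiplicity c. *)
Definition move (g : group) (nu : conf) (c : nat) : conf := mkconf (movef g nu c).

Lemma total3 w F (g : group) : uniq (gpts g) ->
  total w F = F (gx g) * w (gx g) + F (gy g) * w (gy g) + F (gz g) * w (gz g)
    + \sum_(j | j \notin gpts g) F j * w j.
Proof.
rewrite /= !inE andbT negb_or => /andP[/andP[xy xz] yz].
rewrite /total (bigD1 (gx g)) //= (bigD1 (gy g)) 1?eq_sym //=.
rewrite (bigD1 (gz g)) /=; last by rewrite ![gz g == _]eq_sym xz yz.
rewrite !addnA; congr (_ + _); apply: eq_bigl => j.
by rewrite !inE !negb_or andbA.
Qed.

Lemma total_movef w g nu c : uniq (gpts g) -> w (gz g) = w (gx g) + w (gy g) ->
  c <= class_max g nu -> total w (movef g nu c) = total w (fun i => nu i).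
Proof.
move=> ug wz; rewrite leq_min => /andP[cA cB].
rewrite !(total3 w _ ug); congr (_ + _); last first.
  apply: eq_bigr => j; rewrite !inE !negb_or /movef.
  by case/and3P => /negPf-> /negPf-> /negPf->.
move: ug; rewrite /= !inE andbT negb_or => /andP[/andP[xy xz] yz].
rewrite /movef eqxx (negPf xz) (negPf yz) eqxx eq_sym (negPf xy) eqxx wz.
rewrite /gA /gB in cA cB *.
have := subnK cA; have := subnK cB.
set b' := _ - c; set a' := _ - c => hb ha.
have -> : a' * w (gx g) + b' * w (gy g) + c * (w (gx g) + w (gy g))
   = (a' + c) * w (gx g) + (b' + c) * w (gy g) by ring.
by rewrite ha hb; ring.
Qed.

Section Bounded.
Variables (a b : nat).
Hypotheses (aN : a <= N) (bN : b <= N).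

Lemma move_in g nu c : good_group g -> nu \in confs a b -> c <= class_max g nu ->
  move g nu c \in confs a b.
Proof.
move=> /and3P[ug /eqP uz /eqP vz] /confsP[h1 h2] cm.
by apply: mkconf_in; rewrite ?total_movef.
Qed.

Lemma moveE g nu c j : good_group g -> nu \in confs a b -> c <= class_max g nu ->
  move g nu c j = movef g nu c j :> nat.
Proof.
move=> /and3P[ug /eqP uz /eqP vz] /confsP[h1 h2] cm.
by apply: mkconfE; rewrite total_movef ?h1 ?h2.
Qed.

Lemma move_z g nu c : good_group g -> nu \in confs a b -> c <= class_max g nu ->
  move g nu c (gz g) = c :> nat.
Proof. by move=> gg nuV cm; rewrite moveE // /movef eqxx. Qed.

Lemma move_AB g nu c : good_group g -> nu \in confs a b -> c <= class_max g nu ->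
  gA g (move g nu c) = gA g nu /\ gB g (move g nu c) = gB g nu.
Proof.
move=> gg nuV cm; rewrite /gA /gB !moveE //.
case/and3P: gg => ug _ _; move: ug; rewrite /= !inE andbT negb_or.
move=> /andP[/andP[xy xz] yz].
rewrite /movef eqxx (negPf xz) (negPf yz) eqxx eq_sym (negPf xy) eqxx.
by move: cm; rewrite leq_min => /andP[cA cB]; rewrite !subnK.
Qed.

Lemma move_out g nu c j : good_group g -> nu \in confs a b -> c <= class_max g nu ->
  j \notin gpts g -> move g nu c j = nu j.
Proof.
move=> gg nuV cm; rewrite !inE !negb_or => /and3P[/negPf jx /negPf jy /negPf jz].
by apply: val_inj; rewrite /= moveE // /movef jx jy jz.
Qed.

Lemma move_id g nu : good_group g -> nu \in confs a b ->
  move g nu (nu (gz g)) = nu.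
Proof.
move=> gg nuV; apply/ffunP => j; apply: val_inj; rewrite /= moveE //; last first.
  by rewrite leq_min !leq_addl.
rewrite /movef; case: eqP => [->|_] //; case: eqP => [->|_]; first by rewrite addnK.
by case: eqP => [->|_] //; rewrite addnK.
Qed.

Lemma move_move g nu c c' : good_group g -> nu \in confs a b ->
  c <= class_max g nu -> c' <= class_max g nu -> move g (move g nu c) c' = move g nu c'.
Proof.
move=> gg nuV cm cm'.
have [eA eB] := move_AB gg nuV cm.
have em : class_max g (move g nu c) = class_max g nu by rewrite /class_max eA eB.
apply/ffunP => j; apply: val_inj; rewrite /= !moveE ?em // ?move_in //.
rewrite /movef eA eB; case: (eqVneq j (gz g)) => // jz.
case: (eqVneq j (gx g)) => // jx; case: (eqVneq j (gy g)) => // jy.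
by rewrite move_out // !inE !negb_or jx jy jz.
Qed.

Lemma z_le_class_max g (nu : conf) : nu (gz g) <= class_max g nu.
Proof. by rewrite leq_min !leq_addl. Qed.

Definition closed_under (g : group) (S : {set conf}) :=
  forall nu c, nu \in S -> c <= class_max g nu -> move g nu c \in S.

(** Each exchange class is represented by its member without z and parametrized by
the multiplicity of z. *)
Lemma fibre_sum (R : nmodType) (S : {set conf}) g (H : conf -> R) :
  good_group g -> S \subset confs a b -> closed_under g S ->
  (\sum_(nu in S) H nu =
    \sum_(nu in S | nu (gz g) == ord0)
      \sum_(0 <= c < (class_max g nu).+1) H (move g nu c))%R.
Proof.
move=> gg /fintype.subsetP sSV clS.
rewrite (partition_big (fun nu => move g nu 0)
  (fun mu : conf => (mu \in S) && (mu (gz g) == ord0))) /=; last first.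
  by move=> nu nuS; rewrite clS //= -val_eqE /= move_z // sSV.
apply: eq_bigr => mu /andP[muS /eqP muz].
have muV := sSV _ muS; rewrite big_mkord.
have mz0 : move g mu 0 = mu by rewrite -[RHS](move_id gg muV) muz.
rewrite (reindex_onto (fun c : 'I_(class_max g mu).+1 => move g mu c)
           (fun nu : conf => inord (nu (gz g)))) /=.
  apply: eq_bigl => c; have cm : c <= class_max g mu by rewrite -ltnS.
  rewrite clS //= move_move // mz0 eqxx /= -val_eqE /= move_z //.
  by rewrite inordK // eqxx.
move=> nu /andP[nuS /eqP nu0]; have nuV := sSV _ nuS.
have [eA eB] := move_AB gg nuV (leq0n (class_max g nu)).
have em : class_max g mu = class_max g nu by rewrite -nu0 /class_max eA eB.
rewrite inordK ?ltnS ?em ?z_le_class_max // -nu0 move_move ?z_le_class_max //.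
exact: move_id.
Qed.

(** * The affinity of disjoint exchange classes *)

Section Affinity.
Local Open Scope ring_scope.
Variables (R : realType) (r t : R).
Hypothesis r_gt0 : 0 < r.
Hypothesis t_ge0 : 0 <= t.
Hypothesis spread : forall A B, (2 <= minn A B)%N ->
  (\sum_(0 <= c < (minn A B).+1) Num.sqrt (group_weight r A B c)) ^+ 2
    <= t * (minn A B).+1%:R * \sum_(0 <= c < (minn A B).+1) group_weight r A B c.

Definition group_mass (g : group) (nu : conf) : R :=
  group_weight r (gA g nu) (gB g nu) (nu (gz g)).

(** The mean weight over the exchange class of nu. *)
Definition group_mean (g : group) (nu : conf) : R :=
  (\sum_(0 <= c < (class_max g nu).+1) group_weight r (gA g nu) (gB g nu) c)
    / (class_max g nu).+1%:R.

Lemma gw_ge0 g nu : 0 <= group_mass g nu.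
Proof. exact/ltW/group_weight_gt0. Qed.

Lemma gW_ge0 g nu : 0 <= group_mean g nu.
Proof. by rewrite divr_ge0 // sumr_ge0 // => c _; exact/ltW/group_weight_gt0. Qed.

Definition invariant_under (g : group) (S : {set conf}) (T : Type) (F : conf -> T) :=
  forall nu c, nu \in S -> (c <= class_max g nu)%N -> F (move g nu c) = F nu.

Section OneGroup.
Variables (S : {set conf}) (g : group) (F : conf -> R).
Hypotheses (gg : good_group g) (SV : S \subset confs a b) (clS : closed_under g S).
Hypothesis Finv : invariant_under g S F.

Let sSV nu : nu \in S -> nu \in confs a b.
Proof. by apply/fintype.subsetP. Qed.

Lemma one_group_sum (G : nat -> nat -> nat -> R) :
  \sum_(nu in S) F nu * G (gA g nu) (gB g nu) (nu (gz g))
  = \sum_(nu in S | nu (gz g) == ord0)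
      F nu * \sum_(0 <= c < (class_max g nu).+1) G (gA g nu) (gB g nu) c.
Proof.
rewrite (fibre_sum _ gg SV clS); apply: eq_bigr => mu /andP[muS _].
rewrite mulr_sumr; apply: eq_big_nat => c /andP[_ cm].
have muV := sSV muS; rewrite ltnS in cm.
by have [-> ->] := move_AB gg muV cm; rewrite Finv // move_z.
Qed.

Lemma one_group_mass :
  \sum_(nu in S) F nu * group_mass g nu = \sum_(nu in S) F nu * group_mean g nu.
Proof.
rewrite (one_group_sum (group_weight r)).
rewrite (one_group_sum (fun A B _ =>
  (\sum_(0 <= c < (minn A B).+1) group_weight r A B c) / (minn A B).+1%:R)).
apply: eq_bigr => mu _; congr (_ * _).
rewrite sumr_const_nat subn0 -[RHS]mulr_natr -mulrA mulVf ?mulr1 //.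
Qed.

(** A factor sqrt t is gained by replacing the weight of one group by its mean over
the exchange class; one_group_mass shows that the total mass is unchanged. *)
Lemma one_group_affinity :
  (forall nu, nu \in S -> (2 <= class_max g nu)%N) -> (forall nu, 0 <= F nu) ->
  \sum_(nu in S) F nu * Num.sqrt (group_mass g nu)
    <= Num.sqrt t * \sum_(nu in S) F nu * Num.sqrt (group_mean g nu).
Proof.
move=> m2 F0.
rewrite (one_group_sum (fun A B c => Num.sqrt (group_weight r A B c))).
rewrite (one_group_sum (fun A B _ => Num.sqrt
  ((\sum_(0 <= c < (minn A B).+1) group_weight r A B c) / (minn A B).+1%:R))).
rewrite mulr_sumr; apply: ler_sum => mu /andP[muS _].
rewrite mulrCA ler_wpM2l // sumr_const_nat subn0 -/(class_max g mu).
rewrite -[X in _ <= _ * X]mulr_natr.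
have := spread (m2 _ muS); rewrite -/(class_max g mu).
set X := \sum_(_ <= _ < _) Num.sqrt _; set Y := \sum_(_ <= _ < _) _ => XY.
have Y0 : 0 <= Y by rewrite sumr_ge0 // => c _; exact/ltW/group_weight_gt0.
have X0 : 0 <= X by rewrite sumr_ge0 // => c _; exact: sqrtr_ge0.
have nz : (class_max g mu).+1%:R != 0 :> R by rewrite pnatr_eq0.
rewrite -(ler_pXn2r (_ : (0 < 2)%N)) ?nnegrE ?mulr_ge0 ?sqrtr_ge0 //.
apply: (le_trans XY); rewrite !exprMn !sqr_sqrtr ?divr_ge0 //.
by rewrite le_eqVlt; apply/orP; left; apply/eqP; field; rewrite nat1r.
Qed.

End OneGroup.

Lemma group_mass_disjoint g g' nu c : good_group g' -> nu \in confs a b ->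
  (c <= class_max g' nu)%N -> ~~ has (mem (gpts g')) (gpts g) ->
  group_mass g (move g' nu c) = group_mass g nu /\ group_mean g (move g' nu c) = group_mean g nu.
Proof.
move=> gg nuV cm /hasPn dis.
have e j : j \in gpts g -> move g' nu c j = nu j.
  by move=> jg; apply: move_out => //; exact: dis.
have ex := e (gx g); have ey := e (gy g); have ez := e (gz g).
rewrite !inE !eqxx ?orbT /= in ex ey ez.
by rewrite /group_mass /group_mean /class_max /gA /gB ex // ey // ez.
Qed.

(** Disjoint groups do not disturb each other, so the replacement can be iterated,
with one factor sqrt t for each group. *)
Lemma groups_affinity (S : {set conf}) (gs : seq group) (F : conf -> R) :
  all good_group gs -> uniq (flatten (map gpts gs)) -> S \subset confs a b ->
  (forall g, g \in gs -> closed_under g S) ->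
  (forall g, g \in gs -> invariant_under g S F) ->
  (forall g nu, g \in gs -> nu \in S -> (2 <= class_max g nu)%N) ->
  (forall nu, 0 <= F nu) ->
  \sum_(nu in S) F nu * \prod_(g <- gs) Num.sqrt (group_mass g nu)
    <= Num.sqrt t ^+ size gs
         * \sum_(nu in S) F nu * \prod_(g <- gs) Num.sqrt (group_mean g nu) /\
  \sum_(nu in S) F nu * \prod_(g <- gs) group_mass g nu
    = \sum_(nu in S) F nu * \prod_(g <- gs) group_mean g nu.
Proof.
elim: gs F => [|g gs IH] F.
  move=> *; rewrite expr0 mul1r; split; [apply: ler_sum | apply: eq_bigr] => nu _;
  by rewrite !big_nil.
rewrite [all _ _]/= => /andP[gg ggs].
have -> : flatten (map gpts (g :: gs)) = gpts g ++ flatten (map gpts gs) by [].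
rewrite cat_uniq => /and3P[_ dis ugs] SV clS Finv m2 F0.
have sSV nu : nu \in S -> nu \in confs a b by apply/fintype.subsetP.
have disj g' : g' \in gs ->
    ~~ has (mem (gpts g')) (gpts g) /\ ~~ has (mem (gpts g)) (gpts g').
  move=> g'gs.
  suff h : ~~ has (mem (gpts g)) (gpts g') by split=> //; rewrite has_sym.
  apply: contra dis => /hasP[j jg' jg]; apply/hasP; exists j => //.
  by apply/flatten_mapP; exists g'.
have clS' g' : g' \in gs -> closed_under g' S.
  by move=> h; apply: clS; rewrite inE h orbT.
have Finv' g' : g' \in gs -> invariant_under g' S F.
  by move=> h; apply: Finv; rewrite inE h orbT.
have m2' g' nu : g' \in gs -> nu \in S -> (2 <= class_max g' nu)%N.
  by move=> h; apply: m2; rewrite inE h orbT.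
have clSg := clS g (mem_head _ _); have Fg := Finv g (mem_head _ _).
have m2g nu := m2 g nu (mem_head _ _).
have gsg g' nu c : g' \in gs -> nu \in S -> (c <= class_max g nu)%N ->
    group_mass g' (move g nu c) = group_mass g' nu /\ group_mean g' (move g nu c) = group_mean g' nu.
  move=> h nuS cm; have [d1 d2] := disj _ h.
  by apply: group_mass_disjoint => //; exact: sSV.
have ggs' g' nu c : g' \in gs -> nu \in S -> (c <= class_max g' nu)%N ->
    group_mass g (move g' nu c) = group_mass g nu.
  move=> h nuS cm; have [d1 d2] := disj _ h.
  by case: (@group_mass_disjoint g g' nu c) => //; [apply: (allP ggs) | exact: sSV].
split.
  have [h1 _] := IH (fun nu => F nu * Num.sqrt (group_mass g nu)) ggs ugs SV clS'
    (fun g' h nu c nuS cm => congr2 *%R (Finv' g' h nu c nuS cm)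
       (congr1 Num.sqrt (ggs' g' nu c h nuS cm))) m2'
    (fun nu => mulr_ge0 (F0 nu) (sqrtr_ge0 _)).
  have h2 := @one_group_affinity S g
    (fun nu => F nu * \prod_(g' <- gs) Num.sqrt (group_mean g' nu)) gg SV clSg.
  have inv2 : invariant_under g S
      (fun nu => F nu * \prod_(g' <- gs) Num.sqrt (group_mean g' nu)).
    move=> nu c nuS cm; rewrite Fg //; congr (_ * _).
    by apply: eq_big_seq => g' h; have [_ ->] := gsg g' nu c h nuS cm.
  have ge2 nu : 0 <= F nu * \prod_(g' <- gs) Num.sqrt (group_mean g' nu).
    by rewrite mulr_ge0 // prodr_ge0 // => g' _; exact: sqrtr_ge0.
  have {}h2 := h2 inv2 m2g ge2.
  under eq_bigr => nu _ do rewrite big_cons mulrA.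
  apply: (le_trans h1); rewrite exprSr -mulrA ler_wpM2l ?exprn_ge0 ?sqrtr_ge0 //.
  under eq_bigr => nu _ do rewrite mulrAC.
  apply: (le_trans h2); rewrite le_eqVlt; apply/orP; left; apply/eqP.
  congr (_ * _); apply: eq_bigr => nu _.
  by rewrite big_cons mulrAC mulrA.
have [_ h1] := IH (fun nu => F nu * group_mass g nu) ggs ugs SV clS'
    (fun g' h nu c nuS cm => congr2 *%R (Finv' g' h nu c nuS cm)
       (ggs' g' nu c h nuS cm)) m2'
    (fun nu => mulr_ge0 (F0 nu) (gw_ge0 _ _)).
have inv2 : invariant_under g S
      (fun nu => F nu * \prod_(g' <- gs) group_mean g' nu).
  move=> nu c nuS cm; rewrite Fg //; congr (_ * _).
  by apply: eq_big_seq => g' h; have [_ ->] := gsg g' nu c h nuS cm.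
have h2 := one_group_mass gg SV clSg inv2.
under eq_bigr => nu _ do rewrite big_cons mulrA.
rewrite h1; under eq_bigr => nu _ do rewrite mulrAC.
by rewrite h2; apply: eq_bigr => nu _; rewrite big_cons mulrAC mulrA.
Qed.

Definition conf_weight (nu : conf) : R := \prod_i bcoef r (nu i).

Lemma conf_weight_split gs nu : uniq (flatten (map gpts gs)) ->
  conf_weight nu = (\prod_(i | i \notin flatten (map gpts gs)) bcoef r (nu i))
               * \prod_(g <- gs) group_mass g nu.
Proof.
move=> ugs; rewrite /conf_weight (bigID (mem (flatten (map gpts gs)))) /= mulrC.
congr (_ * _); rewrite -big_uniq //= big_flatten big_map.
apply: eq_bigr => g _; rewrite !big_cons big_nil /group_mass /group_weight.
by rewrite /gA /gB !addnK /= mulr1 mulrA.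
Qed.

Lemma sqrtr_prod (J : Type) (s : seq J) (G : J -> R) : (forall j, 0 <= G j) ->
  Num.sqrt (\prod_(j <- s) G j) = \prod_(j <- s) Num.sqrt (G j).
Proof.
move=> G0; elim: s => [|j s IH]; first by rewrite !big_nil sqrtr1.
by rewrite !big_cons sqrtrM // IH.
Qed.

(** After all groups have been averaged, the remaining sum is estimated by
Cauchy-Schwarz. *)
Lemma closed_affinity (S : {set conf}) (gs : seq group) :
  all good_group gs -> uniq (flatten (map gpts gs)) -> S \subset confs a b ->
  (forall g, g \in gs -> closed_under g S) ->
  (forall g nu, g \in gs -> nu \in S -> (2 <= class_max g nu)%N) ->
  \sum_(nu in S) Num.sqrt (conf_weight nu)
    <= Num.sqrt t ^+ size gs * Num.sqrt (#|S|%:R * \sum_(nu in S) conf_weight nu).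
Proof.
move=> ggs ugs SV clS m2.
have sSV nu : nu \in S -> nu \in confs a b by apply/fintype.subsetP.
pose F (nu : conf) := \prod_(i | i \notin flatten (map gpts gs)) bcoef r (nu i).
have F0 nu : 0 <= F nu by apply: prodr_ge0 => i _; exact/ltW/bcoef_gt0.
have Finv g : g \in gs -> invariant_under g S F.
  move=> ggs' nu c nuS cm; apply: eq_bigr => i inot.
  rewrite move_out ?sSV //; first exact: (allP ggs).
  by apply: contra inot => ig; apply/flatten_mapP; exists g.
have [h1 _] := @groups_affinity S gs (fun nu => Num.sqrt (F nu)) ggs ugs SV clS
  (fun g h nu c nuS cm => congr1 _ (Finv g h nu c nuS cm)) m2
  (fun nu => sqrtr_ge0 _).
have [_ h2] := @groups_affinity S gs F ggs ugs SV clS Finv m2 F0.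
under eq_bigr => nu _.
  rewrite (conf_weight_split nu ugs) -/(F nu) sqrtrM // sqrtr_prod; last first.
    by move=> g; exact: gw_ge0.
  over.
apply: (le_trans h1); rewrite ler_wpM2l ?exprn_ge0 ?sqrtr_ge0 //.
have W0 nu : 0 <= F nu * \prod_(g <- gs) group_mean g nu.
  by rewrite mulr_ge0 // prodr_ge0 // => g _; exact: gW_ge0.
rewrite -[leLHS]ger0_norm; last first.
  by apply: sumr_ge0 => nu _; rewrite mulr_ge0 ?sqrtr_ge0 // prodr_ge0 // => *; rewrite sqrtr_ge0.
rewrite -sqrtr_sqr ler_sqrt; last first.
  by rewrite mulr_ge0 // sumr_ge0 // => nu _; apply: prodr_ge0 => i _; exact/ltW/bcoef_gt0.
under [X in _ <= _ * X]eq_bigr => nu _ do rewrite (conf_weight_split nu ugs) -/(F nu).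
rewrite h2 -sum1_card natr_sum.
apply: cauchy_sum => nu _ //; rewrite mul1r -sqrtr_prod; last first.
  by move=> g; exact: gW_ge0.
by rewrite -sqrtrM // sqr_sqrtr.
Qed.

Lemma uniq_flatten_mem (T : eqType) (J : eqType) (f : J -> seq T) s x y j :
  uniq (flatten (map f s)) -> x \in s -> y \in s -> j \in f x -> j \in f y -> x = y.
Proof.
elim: s => //= h s IH; rewrite cat_uniq !inE => /and3P[_ /hasPn dis us].
case/predU1P => [->|xs] /predU1P[->|ys] // jx jy; last exact: IH.
  by have /dis/negP[] // : j \in flatten (map f s) by apply/flatten_mapP; exists y.
by have /dis/negP[] // : j \in flatten (map f s) by apply/flatten_mapP; exists x.
Qed.

Lemma class_max_move gs g g' nu c : all good_group gs -> uniq (flatten (map gpts gs)) ->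
  g \in gs -> g' \in gs -> nu \in confs a b -> (c <= class_max g' nu)%N ->
  class_max g (move g' nu c) = class_max g nu.
Proof.
move=> ggs ugs ggs1 ggs2 nuV cm; have gg' := allP ggs _ ggs2.
have [->|gg] := eqVneq g g'.
  by rewrite /class_max; have [-> ->] := move_AB gg' nuV cm.
have dis j : j \in gpts g -> j \notin gpts g'.
  move=> jg; apply: contra gg => jg'; apply/eqP.
  exact: (uniq_flatten_mem ugs ggs1 ggs2 jg jg').
by rewrite /class_max /gA /gB !move_out // dis // !inE eqxx ?orbT.
Qed.

(** The configurations in which every group has a class of at least three points
form a union of exchange classes; the others are counted by the vectors z of
multiplicity at most 1, because nu z <= class_max g nu. *)
Lemma confs_affinity (gs : seq group) :
  all good_group gs -> uniq (flatten (map gpts gs)) ->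
  \sum_(nu in confs a b) Num.sqrt (conf_weight nu)
    <= (Num.sqrt t ^+ size gs * Num.sqrt #|confs a b|%:R
        + Num.sqrt (\sum_(g <- gs) #|[set nu in confs a b | nu (gz g) < 2]|)%N%:R)
         * Num.sqrt (\sum_(nu in confs a b) conf_weight nu).
Proof.
move=> ggs ugs; set V := confs a b; set bad := (\sum_(g <- gs) _)%N.
pose S := [set nu in V | all (fun g => (2 <= class_max g nu)%N) gs].
have SE nu : (nu \in S) = (nu \in V) && all (fun g => (2 <= class_max g nu)%N) gs.
  by rewrite finset.in_set.
have SV : S \subset V by apply/fintype.subsetP => nu; rewrite SE => /andP[].
have clS g : g \in gs -> closed_under g S.
  move=> ggs1 nu c; rewrite !SE => /andP[nuV /allP m2] cm.
  rewrite move_in ?(allP ggs) //=; apply/allP => g' g'gs.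
  by rewrite (class_max_move ggs ugs g'gs ggs1) // m2.
have m2 g nu : g \in gs -> nu \in S -> (2 <= class_max g nu)%N.
  by move=> ggs1; rewrite SE => /andP[_ /allP]; apply.
have b0 nu : 0 <= conf_weight nu by apply: prodr_ge0 => i _; exact/ltW/bcoef_gt0.
have hS := closed_affinity ggs ugs SV clS m2.
rewrite (bigID (fun nu => nu \in S)) /= mulrDl; apply: lerD.
  rewrite (eq_bigl (fun nu => nu \in S)); last first.
    by move=> nu; rewrite andb_idl //; apply/fintype.subsetP.
  apply: (le_trans hS); rewrite -mulrA ler_wpM2l ?exprn_ge0 ?sqrtr_ge0 //.
  rewrite -sqrtrM // ler_sqrt ?mulr_ge0 ?sumr_ge0 //.
  apply: ler_pM => //; first by rewrite sumr_ge0.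
    by rewrite ler_nat subset_leq_card.
  rewrite [leRHS](bigID (fun nu => nu \in S)) /=.
  rewrite (eq_bigl (fun nu => (nu \in V) && (nu \in S))); last first.
    by move=> nu; rewrite andb_idl //; apply/fintype.subsetP.
  by rewrite lerDl sumr_ge0.
rewrite -sqrtrM // -[leLHS]ger0_norm; last first.
  by rewrite sumr_ge0 // => nu _; exact: sqrtr_ge0.
rewrite -sqrtr_sqr ler_sqrt ?mulr_ge0 ?sumr_ge0 //.
apply: (@le_trans _ _ (#|V :\: S|%:R * \sum_(nu in V | nu \notin S) conf_weight nu)).
  rewrite -sum1_card natr_sum (eq_bigl (fun nu => (nu \in V) && (nu \notin S))).
    by apply: cauchy_sum => nu _ //; rewrite mul1r sqr_sqrtr.
  by move=> nu; rewrite finset.in_setD andbC.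
apply: ler_pM => //; first by rewrite sumr_ge0.
  rewrite ler_nat.
  have sub : V :\: S \subset \bigcup_(g <- gs) [set nu in V | (nu (gz g) < 2)%N].
    apply/fintype.subsetP => nu; rewrite finset.in_setD SE => /andP[nS nuV].
    move: nS; rewrite nuV /= => /allPn[g ggs1]; rewrite -ltnNge => hm.
    rewrite finset.bigcup_seq; apply/finset.bigcupP; exists g => //.
    by rewrite finset.in_set nuV; apply: leq_ltn_trans hm; exact: z_le_class_max.
  apply: (leq_trans (subset_leq_card sub)).
  rewrite /bad; elim: (gs) => [|g s IH]; first by rewrite !big_nil cards0.
  rewrite !big_cons; apply: (leq_trans (leq_card_setU _ _)).
  by rewrite leq_add2l.
by rewrite [leRHS](bigID (fun nu => nu \in S)) /= lerDr sumr_ge0.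
Qed.

End Affinity.
End Bounded.
End Configurations.
(** * Entropy estimates *)

Section FewTypes.
Local Open Scope nat_scope.
Variables (I : finType) (N : nat).

Definition supp (nu : conf I N) : {set I} := [set i | 0 < nu i].

(** A configuration with at most S distinct directions is described by a list of S
directions together with their multiplicities. *)
Lemma card_few_supp (i0 : I) S :
  #|[set nu : conf I N | #|supp nu| <= S]| <= (#|I| * N.+1) ^ S.
Proof.
pose dec (t : {ffun 'I_S -> I * 'I_N.+1}) : conf I N :=
  [ffun i => if [pick s | (t s).1 == i] is Some s then (t s).2 else ord0].
have sub : [set nu : conf I N | #|supp nu| <= S] \subset [set dec t | t in predT].
  apply/fintype.subsetP => nu; rewrite inE => suppS; apply/finset.imsetP.
  pose c (s : 'I_S) : I := nth i0 (enum (supp nu)) s.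
  exists [ffun s => (c s, nu (c s))] => //; apply/ffunP => i; rewrite ffunE.
  case: pickP => [s|none]; first by rewrite ffunE /= => /eqP->.
  apply/eqP; rewrite -val_eqE /= -leqn0 leqNgt; apply/negP => nui.
  have iin : i \in enum (supp nu) by rewrite mem_enum inE.
  have lt : index i (enum (supp nu)) < S.
    by apply: leq_trans suppS; rewrite cardE index_mem.
  by have := none (Ordinal lt); rewrite ffunE /= /c nth_index // eqxx.
apply: leq_trans (subset_leq_card sub) _; apply: leq_trans (leq_imset_card _ _) _.
apply: leq_trans (max_card _) _; by rewrite card_ffun card_prod !card_ord.
Qed.

End FewTypes.

Section CoprimePairs.
Local Open Scope nat_scope.

(** By comparison with the telescoping sum of 1 / d - 1 / (d + 1). *)
Lemma sum_inv_sqr (R : realFieldType) (k : nat) :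
  (\sum_(2 <= d < k.+3) (d%:R ^+ 2)^-1 <= 3 / 4 - (k.+2%:R)^-1 :> R)%R.
Proof.
elim: k => [|k IH]; first by rewrite big_nat1; lra.
rewrite big_nat_recr //=; have := IH; set X := (\sum_(_ <= _ < _) _)%R => h.
suff : ((k.+3%:R ^+ 2)^-1 <= (k.+2%:R)^-1 - (k.+3%:R)^-1 :> R)%R.
  by move=> st; apply: le_trans (lerD h st) _; rewrite addrA subrK.
have h2 : (0 < k.+2%:R :> R)%R by rewrite ltr0n.
have -> : (k.+3%:R = k.+2%:R + 1 :> R)%R by rewrite natr1.
move: (k.+2%:R : R)%R h2 => x x0.
have -> : (x^-1 - (x + 1)^-1 = (x * (x + 1))^-1 :> R)%R.
  by field; rewrite !gt_eqF //; lra.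
rewrite lef_pV2 ?posrE ?mulr_gt0 ?exprn_gt0 //; nra.
Qed.

Lemma sum_divn_sqr m : 4 * (\sum_(2 <= d < m.+1) (m %/ d) ^ 2) <= 3 * m ^ 2.
Proof.
case: m => [|[|k]]; try by rewrite big_geq.
set m := k.+2; rewrite -(ler_nat rat) [leLHS]natrM natr_sum [leRHS]natrM natrX.
apply: (@le_trans _ _ (4 * (m%:R ^+ 2 * \sum_(2 <= d < m.+1) (d%:R ^+ 2)^-1)))%R.
  rewrite ler_pM2l // mulr_sumr !big_nat; apply: ler_sum => d /andP[d2 _].
  have d0 : (0 < d%:R :> rat)%R by rewrite ltr0n; lia.
  rewrite ler_pdivlMr ?exprn_gt0 // natrX -exprMn lerXn2r ?nnegrE // -natrM.
  by rewrite ler_nat leq_trunc_div.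
have := sum_inv_sqr rat k; set X := (\sum_(_ <= _ < _) _)%R => h.
have h2 : (0 <= (k.+2%:R)^-1 :> rat)%R by rewrite invr_ge0.
have m0 : (0 <= m%:R ^+ 2 :> rat)%R by exact: sqr_ge0.
have := ler_wpM2l m0 h; rewrite mulrBr => h3.
have := mulr_ge0 m0 h2; move: h3.
set a := (m%:R ^+ 2 * X)%R; set b := (m%:R ^+ 2 * _^-1)%R.
by move: (m%:R ^+ 2 : rat)%R a b => *; lra.
Qed.

(** At most m %/ d squared pairs are divisible by d, and the sum of the 1 / d ^+ 2
over 2 <= d is less than 3 / 4. *)
Lemma card_coprime_pairs m :
  m ^ 2 <= 4 * #|[set p : 'I_m * 'I_m | coprime p.1.+1 p.2.+1]|.
Proof.
set C := [set p | _].
have sub : ~: C \subset \bigcup_(d <- index_iota 2 m.+1)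
    finset.setX [set i : 'I_m | d %| i.+1] [set i : 'I_m | d %| i.+1].
  apply/fintype.subsetP => -[i j]; rewrite finset.in_setC finset.in_set => nc.
  have gin : gcdn i.+1 j.+1 \in index_iota 2 m.+1.
    rewrite mem_index_iota ltnS; apply/andP; split.
      move: nc; rewrite /coprime /=; have : 0 < gcdn i.+1 j.+1 by rewrite gcdn_gt0.
      by case: (gcdn _ _) => [|[|]].
    by apply: leq_trans (ltn_ord i); apply: dvdn_leq => //; exact: dvdn_gcdl.
  rewrite (big_rem _ gin) /= finset.in_setU finset.in_setX !finset.in_set /=.
  by rewrite dvdn_gcdl dvdn_gcdr.
have cardU (T : finType) (s : seq nat) (F : nat -> {set T}) :
    #|\bigcup_(d <- s) F d| <= \sum_(d <- s) #|F d|.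
  elim: s => [|d s IH]; first by rewrite !big_nil cards0.
  by rewrite !big_cons (leq_trans (leq_card_setU _ _)) // leq_add2l.
have := leq_trans (subset_leq_card sub) (cardU _ _ _).
rewrite (eq_bigr (fun d => (m %/ d) ^ 2)) => [h|d _]; last first.
  rewrite cardsX -mulnn divn_count_dvd big_add1 /= big_mkord -sum1_card big_mkcond /=.
  by congr (_ * _); apply: eq_bigr => i _; rewrite finset.in_set; case: (_ %| _).
have := cardsC C; rewrite card_prod !card_ord => e.
have := sum_divn_sqr m; lia.
Qed.

End CoprimePairs.
(** * Primitive directions in a box *)

Section Directions.
Local Open Scope nat_scope.
Variable N : nat.

Definition dirs := {x : 'I_N.+1 * 'I_N.+1 | coprime x.1 x.2}.
Definition dx (i : dirs) : nat := (val i).1.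
Definition dy (i : dirs) : nat := (val i).2.

Lemma dir_coprime i : coprime (dx i) (dy i).
Proof. exact: valP i. Qed.

Lemma dir_inj i j : dx i = dx j -> dy i = dy j -> i = j.
Proof.
move=> ex ey; apply: val_inj; case: i j ex ey => [[a b] p] [[c d] q].
by rewrite /dx /dy /= => e1 e2; congr pair; apply: val_inj.
Qed.

Lemma dir_gt0 i : 0 < dx i + dy i.
Proof. by have := dir_coprime i; case: (dx i) => [|k] //; case: (dy i). Qed.

Lemma dx_le i : dx i <= N. Proof. by rewrite -ltnS ltn_ord. Qed.
Lemma dy_le i : dy i <= N. Proof. by rewrite -ltnS ltn_ord. Qed.

(** Meaningful for coprime a and b that are at most N, see mkdirE; i0 is only the
default value of insubd. *)
Definition mkdir (i0 : dirs) (a b : nat) : dirs := insubd i0 (inord a, inord b).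

Lemma mkdirE i0 a b : coprime a b -> a <= N -> b <= N ->
  dx (mkdir i0 a b) = a /\ dy (mkdir i0 a b) = b.
Proof.
move=> cab aN bN; rewrite /dx /dy val_insubd.
have -> : coprime (@inord N a, @inord N b).1 (@inord N a, @inord N b).2.
  by rewrite /= !inordK.
by rewrite /= !inordK.
Qed.

Lemma ex_dir a b : coprime a b -> a <= N -> b <= N ->
  exists i : dirs, dx i = a /\ dy i = b.
Proof.
move=> cab aN bN.
have c : coprime (@inord N a, @inord N b).1 (@inord N a, @inord N b).2.
  by rewrite /= !inordK.
by exists (exist (fun x : 'I_N.+1 * 'I_N.+1 => coprime x.1 x.2) _ c); rewrite /dx /dy /= !inordK.
Qed.

Lemma card_dirs : #|{: dirs}| <= N.+1 ^ 2.
Proof. by rewrite card_sig (leq_trans (max_card _)) // card_prod !card_ord. Qed.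

Notation V := (confs dx dy N).

(** Every set D of primitive vectors with coordinates between 1 and m has sum at
most (m ^ 3, m ^ 3), and multiples of (1, 0) and (0, 1), which are not in D,
complete it to a configuration with endpoint (a, b). *)
Lemma confs_lower_bound a b m : a <= N -> b <= N -> m ^ 3 <= a -> m ^ 3 <= b ->
  0 < m -> 2 ^ (m ^ 2 %/ 4) <= #|V a b|.
Proof.
move=> aN bN ma mb m0.
have m1N : 1 <= N by apply: leq_trans aN; apply: leq_trans ma; rewrite expn_gt0 m0.
have mm3 : m <= m ^ 3 by rewrite expnS leq_pmulr // expn_gt0 m0.
have mN : m <= N by apply: leq_trans aN; exact: leq_trans ma.
have [e [ex ey]] := @ex_dir 1 0 isT m1N (leq0n N).
have [f [fx fy]] := @ex_dir 0 1 isT (leq0n N) m1N.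
pose J := [set i : dirs | [&& 0 < dx i, 0 < dy i, dx i <= m & dy i <= m]].
have J4 : m ^ 2 %/ 4 <= #|J|.
  suff : #|[set p : 'I_m * 'I_m | coprime p.1.+1 p.2.+1]| <= #|J|.
    by have := card_coprime_pairs m; lia.
  have pE (p : 'I_m * 'I_m) : p \in [set p : 'I_m * 'I_m | coprime p.1.+1 p.2.+1] ->
      dx (mkdir e p.1.+1 p.2.+1) = p.1.+1 /\ dy (mkdir e p.1.+1 p.2.+1) = p.2.+1.
    rewrite inE => cp; apply: mkdirE => //; exact: leq_trans (ltn_ord _) mN.
  apply: (@card_le_inj _ _ (fun p : 'I_m * 'I_m => mkdir e p.1.+1 p.2.+1)).
    move=> p q /pE[p1 p2] /pE[q1 q2] pq; move: p1 p2; rewrite pq q1 q2.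
    case: p q {pq q1 q2} => [p1 p2] [q1 q2] /= [e1] [e2].
    by congr pair; apply: val_inj.
  by move=> p /pE[p1 p2]; rewrite inE p1 p2 /= !ltn_ord.
have Jm : #|J| <= m ^ 2.
  have -> : m ^ 2 = #|{: 'I_m * 'I_m}| by rewrite card_prod !card_ord.
  case: m m0 @J J4 {ma mb mm3 mN} => // m' _ J _.
  pose h (i : dirs) : 'I_m'.+1 * 'I_m'.+1 := (inord (dx i).-1, inord (dy i).-1).
  apply: leq_trans (_ : #|h @: J| <= _); last exact: max_card.
  rewrite card_in_imset // => i j; rewrite !inE => /and4P[i1 i2 i3 i4] /and4P[j1 j2 j3 j4].
  case=> /(congr1 (@nat_of_ord _)) + /(congr1 (@nat_of_ord _)).
  rewrite !inordK; try lia.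
  by move=> h1 h2; apply: dir_inj; lia.
have tots w (D : {set dirs}) : (forall i, i \in J -> w i <= m) -> D \subset J ->
    \sum_(i in D) w i <= m ^ 3.
  move=> wm /fintype.subsetP DJ; apply: (@leq_trans (#|D| * m)).
    by rewrite -sum_nat_const; apply: leq_sum => i iD; apply/wm/DJ.
  rewrite (expnSr m 2) leq_mul2r (leq_trans _ Jm) ?orbT //.
  by apply: subset_leq_card; apply/fintype.subsetP.
pose F (D : {set dirs}) (i : dirs) : nat := (i \in D)
  + (delta e (a - \sum_(i in D) dx i) i + delta f (b - \sum_(i in D) dy i) i).
have FE D : D \in powerset J -> total dx (F D) = a /\ total dy (F D) = b.
  rewrite powersetE => DJ.
  have ind w : total w (fun i => (i \in D) : nat) = \sum_(i in D) w i.
    by rewrite /total [RHS]big_mkcond; apply: eq_bigr => i _; case: (_ \in _); rewrite ?mul1n.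
  rewrite !totalD !total_delta !ind ex ey fx fy !muln1 !muln0 addn0 add0n.
  by rewrite !subnKC //; [apply: leq_trans mb|apply: leq_trans ma]; apply: tots => // i;
    rewrite inE => /and4P[].
apply: (@leq_trans #|powerset J|); first by rewrite card_powerset leq_pexp2l.
apply: (@card_le_inj _ _ (fun D => mkconf N (F D))).
  move=> D1 D2 D1J D2J eqD; have [h1 h2] := FE _ D1J; have [h3 h4] := FE _ D2J.
  apply/finset.setP => i.
  have [iJ|iJ] := boolP (i \in J); last first.
    move: D1J D2J; rewrite !powersetE => /fintype.subsetP s1 /fintype.subsetP s2.
    by rewrite (contraNF (s1 i)) // (contraNF (s2 i)).
  have := congr1 (fun nu : conf dirs N => nat_of_ord (nu i)) eqD.
  rewrite !(mkconfE dir_gt0) ?h1 ?h2 ?h3 ?h4 // /F /delta.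
  have -> : (i == e) = false.
    by apply: contraTF iJ => /eqP->; rewrite inE ey /= andbF.
  have -> : (i == f) = false.
    by apply: contraTF iJ => /eqP->; rewrite inE fx.
  by rewrite !mul0n !addn0; case: (i \in D1); case: (i \in D2).
by move=> D /FE[h1 h2]; apply: mkconf_in => //; exact: dir_gt0.
Qed.

Lemma card_pairs (T U : finType) (Q : {set T}) (B : T -> {set U}) :
  #|[set p : T * U | (p.1 \in Q) && (p.2 \in B p.1)]| = \sum_(x in Q) #|B x|.
Proof.
rewrite -sum1_card (eq_bigr (fun x => \sum_(y in B x) 1)); last first.
  by move=> x _; rewrite sum1_card.
by rewrite pair_big_dep /=; apply: eq_bigl => p; rewrite finset.in_set.
Qed.

(** Remove the greatest element, which is at least the number of the others. *)
Lemma card_distinct_sum (B : {set 'I_N.+1}) :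
  #|B| * #|B|.-1 <= 2 * \sum_(b in B) b.
Proof.
have [k] : {k | k = #|B|} by exists #|B|.
elim: k B => [|k IH] B Bk; first by rewrite -Bk.
have [b0 b0B] : exists b, b \in B by apply/card_gt0P; rewrite -Bk.
case: (arg_maxnP (fun b : 'I_N.+1 => nat_of_ord b) b0B) => bm bmB bmax.
have {}bmB : bm \in B := bmB; have {}bmax j : j \in B -> j <= bm := bmax j.
have cB : #|B| = #|B :\ bm|.+1 by rewrite (cardsD1 bm B) bmB.
have := IH (B :\ bm); rewrite -Bk in cB; case: cB => <- /(_ erefl) h.
rewrite -Bk /= (bigD1 bm) //= mulnDr.
have -> : \sum_(i in B | i != bm) i = \sum_(i in B :\ bm) i.
  by apply: eq_bigl => i; rewrite !inE andbC.
suff : k <= bm by move: h; set s := \sum_(_ in _) _; case: (k) => [|j] /=; nia.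
rewrite -ltnS Bk -[X in _ <= X]card_ord.
pose g (b : 'I_N.+1) : 'I_bm.+1 := inord b.
apply: (@leq_trans #|g @: B|); last exact: max_card.
rewrite card_in_imset // => i j iB jB /(congr1 (@nat_of_ord _)).
by rewrite !inordK ?ltnS; [exact: val_inj|exact: bmax|exact: bmax].
Qed.

(** The multivalued map behind the estimate: in a configuration without
e = (1, 0), trade one y for (dx y).-1 copies of e and one copy of (1, dy y).
At least S vectors y are available, and the result determines y up to the choice
of dy y among the b for which (1, b) occurs, of which there are at most t. *)
Lemma card_no_horizontal a b S t (e : dirs) : dx e = 1 -> dy e = 0 -> a <= N -> b <= N ->
  (forall k, k * k.-1 <= 2 * N -> k <= t) ->
  #|[set nu in V a b | (nu e == ord0) && (S < #|supp nu|)]| * S <= #|V a b| * t.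
Proof.
move=> ex ey aN bN ht; set Q := [set nu in _ | _].
have N1 : 1 <= N by rewrite -ex dx_le.
pose z (c : nat) := mkdir e 1 c.
have zE c : c <= N -> dx (z c) = 1 /\ dy (z c) = c.
  by move=> cN; apply: mkdirE => //; rewrite coprime1n.
pose B1 (nu : conf dirs N) := [set y : dirs | (0 < nu y) && (0 < dx y)].
pose B2 (nu : conf dirs N) := [set c : 'I_N.+1 | 0 < nu (z c)].
have h1 : #|Q| * S <= \sum_(nu in Q) #|B1 nu|.
  rewrite -sum_nat_const; apply: leq_sum => nu.
  rewrite finset.in_set => /and3P[_ _ Ss].
  have [f [fx fy]] := @ex_dir 0 1 isT (leq0n N) N1.
  have sub : supp nu :\ f \subset B1 nu.
    apply/fintype.subsetP => y; rewrite !inE => /andP[yf ->] /=.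
    rewrite lt0n; apply: contra yf => /eqP y0; apply/eqP/dir_inj; rewrite ?fx ?fy //.
    by have := dir_coprime y; rewrite y0 /coprime gcd0n => /eqP.
  apply: leq_trans (subset_leq_card sub).
  by move: Ss; rewrite (cardsD1 f (supp nu)); case: (f \in _); lia.
have h2 : \sum_(nu in V a b) #|B2 nu| <= #|V a b| * t.
  rewrite -sum_nat_const; apply: leq_sum => nu /confsP[_ hb].
  apply: ht; apply: leq_trans (card_distinct_sum _) _; rewrite leq_mul2l /=.
  apply: leq_trans bN; rewrite -hb.
  apply: (@leq_trans (\sum_(c in B2 nu) nu (z c) * dy (z c))).
    apply: leq_sum => c; rewrite inE => nz; have [_ ->] := zE c (leq_ord c).
    by rewrite leq_pmull.
  have zinj : {in B2 nu &, injective (fun c : 'I_N.+1 => z c)}.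
    move=> c c' _ _ zz; apply: val_inj.
    have [_ h3] := zE c (leq_ord c); have [_ h4] := zE c' (leq_ord c').
    by rewrite /= -h3 zz.
  rewrite -(big_imset (fun i => nu i * dy i) zinj) /= /total.
  by rewrite [leqRHS](bigID (mem ((fun c : 'I_N.+1 => z c) @: B2 nu))) /= leq_addr.
apply: (leq_trans h1); apply: leq_trans h2.
rewrite -!card_pairs.
(* The trade, on the configuration p.1 and its direction p.2. *)
pose Phi (p : conf dirs N * dirs) (i : dirs) : nat :=
  (p.1 i - delta p.2 1 i) + (delta e (dx p.2).-1 i + delta (z (dy p.2)) 1 i).
have A1 p : p \in [set p : conf dirs N * dirs | (p.1 \in Q) && (p.2 \in B1 p.1)] ->
   [/\ p.1 e = ord0, 0 < dx p.2, forall i, p.1 i - delta p.2 1 i + delta p.2 1 i = p.1 i,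
     total dx (Phi p) = a & total dy (Phi p) = b].
  rewrite finset.in_set => /andP[]; rewrite !finset.in_set.
  move=> /and3P[/andP[/eqP h3 /eqP h4] /eqP h5 _] /andP[h6 h7].
  have e1 i : p.1 i - delta p.2 1 i + delta p.2 1 i = p.1 i.
    by rewrite subnK // /delta; case: eqP => [->|].
  have [z1 z2] := zE (dy p.2) (dy_le _).
  split=> //; rewrite !totalD !total_delta ?ex ?ey ?z1 ?z2.
    by rewrite -h3 -(eq_total dx e1) totalD total_delta !mul1n !muln1 addn1 prednK.
  by rewrite -h4 -(eq_total dy e1) totalD total_delta muln0 add0n.
apply: (@card_le_inj _ _ (fun p => (mkconf N (Phi p), inord (dy p.2) : 'I_N.+1))).
  move=> p q /A1[p1 p2 p3 p4 p5] /A1[q1 q2 q3 q4 q5] [eqPhi eqy].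
  have {}eqy : dy p.2 = dy q.2.
    by have := congr1 (@nat_of_ord _) eqy; rewrite !inordK ?ltnS ?dy_le.
  have PhiE i : Phi p i = Phi q i.
    have := congr1 (fun nu : conf dirs N => nat_of_ord (nu i)) eqPhi.
    by rewrite !(mkconfE dir_gt0) ?p4 ?p5 ?q4 ?q5.
  have y12 : p.2 = q.2.
    apply: dir_inj => //; have := PhiE e.
    rewrite /Phi p1 q1 !sub0n !add0n eqy => /addIn.
    by rewrite /delta eqxx !mul1n => hp; rewrite -(prednK p2) hp prednK.
  have n12 : p.1 = q.1.
    apply/ffunP => i; apply: val_inj; have := PhiE i; rewrite /Phi y12 => /addIn h.
    by rewrite /= -p3 -q3 y12 h.
  by case: p q y12 n12 {p1 p2 p3 p4 p5 q1 q2 q3 q4 q5 eqPhi eqy PhiE} => ? ? [? ?] /= -> ->.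
move=> p /A1[p1 p2 p3 p4 p5]; rewrite finset.in_set /=.
rewrite (mkconf_in dir_gt0) //= finset.in_set.
rewrite inordK ?ltnS ?dy_le // (mkconfE dir_gt0) ?p4 ?p5 //.
by rewrite /Phi /delta eqxx !addnA addn1.
Qed.

End Directions.
(** * Moving the endpoint by one unit *)

Section Ratio.
Local Open Scope nat_scope.

Lemma poly_le_exp D d : exists k0, forall k, k0 <= k -> D * k ^ d <= 2 ^ k.
Proof.
exists (D * d.+1 ^ d * d.+1).+1 => k hk; pose j := k %/ d.+1.
have kj : k <= d.+1 * j.+1.
  by rewrite mulnC (leq_trans (ltnW (ltn_ceil k (ltn0Sn d)))).
have jD : D * d.+1 ^ d <= j by rewrite leq_divRL // ltnW.
apply: (@leq_trans ((2 ^ j) ^ d.+1)); last first.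
  by rewrite -expnM leq_pexp2l // leq_trunc_div.
apply: (@leq_trans (j.+1 ^ d.+1)); last by rewrite leq_exp2r // ltn_expl.
apply: (@leq_trans (D * (d.+1 * j.+1) ^ d)).
  rewrite leq_mul2l; apply/orP; right.
  by case: (d) kj => [|d'] kj //; rewrite leq_exp2r.
by rewrite expnMn mulnA expnS leq_mul2r (leq_trans jD) ?orbT.
Qed.

Lemma card_few_types N S : #|[set nu : conf (dirs N) N | #|supp nu| <= S]| <= (N.+1 ^ 3) ^ S.
Proof.
have [->|N0] := posnP N.
  apply: leq_trans (max_card _) _; rewrite card_ffun card_ord exp1n.
  by rewrite !exp1n.
have [e _] := ex_dir (isT : coprime 1 0) N0 (leq0n N).
have h := @card_few_supp (dirs N) N e S; apply: (leq_trans h) => {h}.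
by case: S => [|S] //; rewrite leq_exp2r // expnSr leq_mul // card_dirs.
Qed.

Section Fixed.
Variables (N a b : nat).
Notation V := (confs (@dx N) (@dy N) N).

Lemma card_lost_by_horizontal (e : dirs N) S : dx e = 1 -> dy e = 0 ->
  a <= N -> b <= N -> 0 < a ->
  #|V a b| - #|V a.-1 b| <=
    #|[set nu in V a b | (nu e == ord0) && (S < #|supp nu|)]|
    + #|[set nu : conf (dirs N) N | #|supp nu| <= S]|.
Proof.
move=> ex ey aN bN a0.
have := @card_confs_sub _ _ _ _ (@dir_gt0 N) a b e 1 aN bN.
rewrite ex ey !muln1 muln0 subn0 subn1 => /(_ a0 (leq0n b)) ->.
rewrite leq_subLR; apply: leq_trans (leq_add (leqnn _) (leq_card_setU _ _)).
apply: leq_trans (leq_card_setU _ _); apply: subset_leq_card.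
apply/fintype.subsetP => nu; rewrite !finset.in_setU !finset.in_set => -> /=.
by rewrite -val_eqE /= lt0n; case: eqP => //= _; case: ltnP.
Qed.

(** With l = 4 k, the endpoint is of order l ^ 12.  The threshold l ^ 7 for the
number of distinct directions exceeds the O(l ^ 6) choices in
card_no_horizontal by a factor of order l.  The configurations below the
threshold number at most poly(l) ^ (l ^ 7), against at least 2 ^ (k * l ^ 7)
configurations in all, by confs_lower_bound with m = l ^ 4. *)
Lemma axis_ratio_step (q C k : nat) : 0 < a -> a <= N -> b <= N ->
  0 < k -> 0 < C -> (4 * k) ^ 12 <= a -> (4 * k) ^ 12 <= b ->
  N <= C * (4 * k) ^ 12 -> 6 * q * C <= 4 * k ->
  2 * q * (2 * C * 4 ^ 12) ^ 3 * k ^ 36 <= 2 ^ k ->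
  q * (#|V a b| - #|V a.-1 b|) <= #|V a b|.
Proof.
move=> a0 aN bN k0 C0 ka kb NC qC big; set l := 4 * k in ka kb NC qC.
have N1 : 1 <= N by exact: leq_trans aN.
have [e [ex ey]] := ex_dir (isT : coprime 1 0) N1 (leq0n N).
have l0 : 0 < l by rewrite /l muln_gt0.
have l6 : 0 < l ^ 6 by rewrite expn_gt0 l0.
have l12 : l ^ 12 = l ^ 6 * l ^ 6 by rewrite -expnD.
have ht j : j * j.-1 <= 2 * N -> j <= 3 * C * l ^ 6.
  move=> hj; rewrite leqNgt; apply/negP => hj2.
  have : 2 * N < j * j.-1; last by rewrite ltnNge hj.
  have : 2 * N <= 2 * (C * (l ^ 6 * l ^ 6)) by rewrite leq_mul2l -l12 NC.
  move: hj2 l6; set L := l ^ 6 => hj2 l6 h; apply: leq_ltn_trans h _.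
  have CL : L <= C * L by rewrite leq_pmull.
  have h1 : 3 * (C * L) <= j.-1 by rewrite mulnA; lia.
  apply: (@leq_trans (j.-1 * j.-1)); last by rewrite leq_mul2r leq_pred orbT.
  apply: (@leq_trans (3 * (C * L) * (3 * (C * L)))); last by exact: leq_mul.
  have X0 : 0 < C * L by rewrite muln_gt0 C0.
  rewrite [C * (L * L)]mulnA mulnACA; move: (C * L) CL X0 => X CL X0.
  have XX : 0 < X * X by rewrite muln_gt0 X0.
  apply: (@leq_ltn_trans (2 * (X * X))); first by rewrite !leq_mul2l CL !orbT.
  by rewrite ltn_mul2r XX.
have hQ := card_no_horizontal (l ^ 7) ex ey aN bN ht.
have hF := card_few_types N (l ^ 7).
have hV : 2 ^ (k * l ^ 7) <= #|V a b|.
  have := @confs_lower_bound N a b (l ^ 4) aN bN.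
  rewrite -!expnM => /(_ ka kb); rewrite expn_gt0 l0 => /(_ isT).
  have -> : l ^ (4 * 2) %/ 4 = k * l ^ 7; last by [].
  by rewrite -[4 * 2]/(7.+1) expnS -mulnA mulKn.
have hz := card_lost_by_horizontal (l ^ 7) ex ey aN bN a0.
move: hQ hF hz; set Q := #|[set nu in _ | _]|; set F := #|[set nu : conf _ _ | _]|.
move=> hQ hF hz.
have q2Q : 2 * q * Q <= #|V a b|.
  have l7 : 0 < l ^ 7 by rewrite expn_gt0 l0.
  rewrite -(leq_pmul2r l7) -mulnA; apply: (@leq_trans (2 * q * (#|V a b| * (3 * C * l ^ 6)))).
    by rewrite leq_mul2l hQ orbT.
  have -> : 2 * q * (#|V a b| * (3 * C * l ^ 6)) = #|V a b| * ((6 * q * C) * l ^ 6) by ring.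
  by rewrite [l ^ 7]expnS leq_mul2l leq_mul2r qC !orbT.
have q2F : 2 * q * F <= #|V a b|.
  apply: leq_trans hV; rewrite expnM.
  have l7 : 0 < l ^ 7 by rewrite expn_gt0 l0.
  apply: (@leq_trans ((2 * q) ^ (l ^ 7) * (N.+1 ^ 3) ^ (l ^ 7))).
    apply: leq_mul hF; case: (posnP (2 * q)) => [->|q0] //.
    by rewrite -{1}[2 * q]expn1 leq_pexp2l.
  rewrite -expnMn leq_exp2r //; apply: leq_trans big.
  rewrite -[leqRHS]mulnA leq_mul2l; apply/orP; right.
  have -> : k ^ 36 = (k ^ 12) ^ 3 by rewrite -expnM.
  rewrite -expnMn leq_exp2r // -[leqRHS]mulnA -expnMn -/l -mulnA mul2n -addnn.
  apply: (@leq_trans (N + C * l ^ 12)); last by rewrite leq_add2r.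
  by rewrite -addn1 leq_add2l muln_gt0 C0 expn_gt0 l0.
apply: (@leq_trans (q * (Q + F))); first by rewrite leq_mul2l hz orbT.
rewrite -(leq_pmul2l (isT : 0 < 2)) mulnA mulnDr.
by apply: leq_trans (leq_add q2Q q2F) _; rewrite addnn mul2n.
Qed.

(** The reflection exchanging the two axes; its argument serves as the dummy value
of insubd. *)
Definition swapd (i : dirs N) : dirs N :=
  insubd i ((val i).2, (val i).1).

Lemma swapdE i : dx (swapd i) = dy i /\ dy (swapd i) = dx i.
Proof.
by rewrite /dx /dy val_insubd /= coprime_sym; have := dir_coprime i => ->.
Qed.

Lemma swapdK : involutive swapd.
Proof.
move=> i; have [h1 h2] := swapdE i; have [h3 h4] := swapdE (swapd i).
by apply: dir_inj; rewrite ?h3 ?h4.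
Qed.

End Fixed.

Lemma confs_swap_le N a b :
  #|confs (@dx N) (@dy N) N a b| <= #|confs (@dx N) (@dy N) N b a|.
Proof.
apply: (@card_le_inj _ _ (fun nu : conf (dirs N) N => [ffun i => nu (swapd i)])).
  move=> nu mu _ _ /ffunP e; apply/ffunP => i.
  by have := e (swapd i); rewrite !ffunE swapdK.
have tot (w w' : dirs N -> nat) (nu : conf (dirs N) N) : (forall i, w (swapd i) = w' i) ->
    total w (fun i => [ffun i => nu (swapd i)] i) = total w' (fun i => nu i).
  move=> ww; rewrite /total (reindex_inj (inv_inj (@swapdK N))) /=.
  by apply: eq_bigr => i _; rewrite ffunE swapdK ww.
move=> nu /confsP[ha hb]; apply/confsP; split.
  by rewrite (tot _ _ _ (fun i => (swapdE i).1)).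
by rewrite (tot _ _ _ (fun i => (swapdE i).2)).
Qed.

Lemma confs_swap N a b :
  #|confs (@dx N) (@dy N) N a b| = #|confs (@dx N) (@dy N) N b a|.
Proof. by apply/eqP; rewrite eqn_leq !confs_swap_le. Qed.

(** The proportion of configurations that is lost when the endpoint moves by one
unit along an axis tends to 0, uniformly for balanced endpoints. *)
Lemma axis_ratio (C q : nat) : exists n0, forall N a b,
  n0 <= a -> n0 <= b -> a <= N -> b <= N -> N <= C * a -> N <= C * b ->
  let V := confs (@dx N) (@dy N) N in
  q * (#|V a b| - #|V a.-1 b|) <= #|V a b| /\
  q * (#|V a b| - #|V a b.-1|) <= #|V a b|.
Proof.
pose C' := C.+1 * 2 ^ 12.
have C'0 : 0 < C' by rewrite muln_gt0 expn_gt0.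
have [k0 hk0] := poly_le_exp (2 * q * (2 * C' * 4 ^ 12) ^ 3) 36.
exists ((4 * (maxn k0 (6 * q * C')).+1) ^ 12) => N a b ha hb aN bN NCa NCb V.
set K := maxn _ _ in ha hb; pose m := minn a b.
have hm : (4 * K.+1) ^ 12 <= m by rewrite leq_min ha hb.
have ex : exists k, (4 * k) ^ 12 <= m by exists K.+1.
have ub k : (4 * k) ^ 12 <= m -> k <= m.
  move=> hk; apply: leq_trans hk; apply: (@leq_trans (4 * k)); first by rewrite leq_pmull.
  by case: (posnP (4 * k)) => [->//|p]; rewrite -{1}[4 * k]expn1 leq_pexp2l.
case: (ex_maxnP ex ub) => k km kmax.
have Kk : K < k by exact: kmax.
have k_gt0 : 0 < k by apply: leq_ltn_trans Kk.
have [ka kb] : (4 * k) ^ 12 <= a /\ (4 * k) ^ 12 <= b.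
  by move: km; rewrite leq_min => /andP[].
have a0 : 0 < a by apply: leq_trans ka; rewrite expn_gt0 muln_gt0 k_gt0.
have b0 : 0 < b by apply: leq_trans kb; rewrite expn_gt0 muln_gt0 k_gt0.
have NC : N <= C' * (4 * k) ^ 12.
  apply: (@leq_trans (C.+1 * m)).
    apply: (@leq_trans (C * m)); last by rewrite leq_mul2r leqnSn orbT.
    by rewrite /m /minn; case: (_ < _).
  rewrite /C' -mulnA leq_mul2l /= -expnMn.
  apply: ltnW; rewrite ltnNge; apply/negP => h.
  have : k.+1 <= k; last by rewrite ltnn.
  apply: kmax; apply: leq_trans h; rewrite leq_exp2r // mulnCA leq_mul2l /=.
  by rewrite mul2n -addnn -addn1 leq_add2l.
have qC : 6 * q * C' <= 4 * k.
  apply: (@leq_trans k); last by rewrite leq_pmull.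
  by apply: leq_trans (ltnW Kk); rewrite leq_maxr.
have big := hk0 k (leq_trans (leq_maxl _ _) (ltnW Kk)).
split; first exact: (axis_ratio_step a0 aN bN k_gt0 C'0 ka kb NC qC big).
rewrite /V (confs_swap N a b) (confs_swap N a b.-1).
exact: (axis_ratio_step b0 bN aN k_gt0 C'0 kb ka NC qC big).
Qed.

End Ratio.
(** * Vanishing affinity *)

Section Core.
Local Open Scope nat_scope.
Notation V N := (confs (@dx N) (@dy N) N).

Lemma confs_mono N a b : a <= N -> b <= N ->
  (0 < a -> #|V N a.-1 b| <= #|V N a b|) /\ (0 < b -> #|V N a b.-1| <= #|V N a b|).
Proof.
move=> aN bN.
have sub (i : dirs N) : 1 * dx i <= a -> 1 * dy i <= b ->
    #|V N (a - 1 * dx i) (b - 1 * dy i)| <= #|V N a b|.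
  move=> ha hb; rewrite (card_confs_sub (@dir_gt0 N)) //.
  by apply: subset_leq_card; apply/fintype.subsetP => nu; rewrite finset.in_set => /andP[].
split=> p0.
  have [e [ex ey]] := ex_dir (isT : coprime 1 0) (leq_trans p0 aN) (leq0n N).
  by have := sub e; rewrite ex ey !mul1n subn1 subn0; apply.
have [e [ex ey]] := ex_dir (isT : coprime 0 1) (leq0n N) (leq_trans p0 bN).
by have := sub e; rewrite ex ey !mul1n subn1 subn0; apply.
Qed.

(** Since the cardinals increase with the endpoint, the losses of s + t unit steps
add up to at most s + t times the loss of one step. *)
Lemma descent (C q : nat) : exists n0, forall N a b s t,
  n0 <= a -> n0 <= b -> a + s <= N -> b + t <= N -> N <= C * a -> N <= C * b ->
  #|V N a b| <= #|V N (a + s) (b + t)| /\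
  q * (#|V N (a + s) (b + t)| - #|V N a b|) <= (s + t) * #|V N (a + s) (b + t)|.
Proof.
have [n0 hn0] := axis_ratio C q; exists n0 => N a b s t ha hb asN btN Ca Cb.
have step x y z n : x <= y -> q * (y - x) <= n * y -> y <= z -> q * (z - y) <= z ->
    x <= z /\ q * (z - x) <= n.+1 * z.
  move=> xy h1 yz h2; split; first exact: leq_trans yz.
  have -> : z - x = (z - y) + (y - x) by lia.
  rewrite mulnDr mulSn; apply: leq_add => //; apply: leq_trans h1 _.
  by rewrite leq_mul2l yz orbT.
have grow c d : N <= C * c -> N <= C * (c + d).
  by move=> h; apply: leq_trans h _; rewrite leq_mul2l leq_addr orbT.
elim: t btN => [|t IHt] btN.
  rewrite !addn0 in btN *; elim: s asN => [|s IHs] asN.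
    by rewrite !addn0 subnn muln0.
  have [h1 h2] := IHs (leq_trans (leq_add (leqnn a) (leqnSn s)) asN).
  have [h3 _] := confs_mono asN btN.
  have [h4 _] := hn0 N (a + s.+1) b (leq_trans ha (leq_addr _ _)) hb asN btN
    (grow _ _ Ca) Cb.
  by apply: step h1 h2 _ _; move: h3 h4; rewrite addnS /=; [move=> + _; apply|].
have [h1 h2] := IHt (leq_trans (leq_add (leqnn b) (leqnSn t)) btN).
have [_ h3] := confs_mono asN btN.
have [_ h4] := hn0 N (a + s) (b + t.+1) (leq_trans ha (leq_addr _ _))
  (leq_trans hb (leq_addr _ _)) asN btN (grow _ _ Ca) (grow _ _ Cb).
rewrite [s + t.+1]addnS; apply: step h1 h2 _ _; move: h3 h4; rewrite addnS /=; last by [].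
by move=> + _; apply.
Qed.

(** The configurations with nu z <= 1 are those lost when the endpoint moves by 2 z. *)
Lemma rarely_lt2 (K q x y : nat) : exists n0, forall a b,
  n0 <= a -> n0 <= b -> a <= K * b -> b <= K * a -> forall z : dirs (a + b),
  dx z = x -> dy z = y ->
  q * #|[set nu in V (a + b) a b | nu z < 2]| <= #|V (a + b) a b|.
Proof.
have [n0 hn0] := descent (2 * K.+1) (q * (2 * x + 2 * y)).
exists (n0 + 4 * x + 4 * y) => a b ha hb aK bK z zx zy.
have N1 : a + b <= K.+1 * a by rewrite mulSn; lia.
have N2 : a + b <= K.+1 * b by rewrite mulSn; lia.
have [a' ea] : exists a', a = a' + 2 * x by exists (a - 2 * x); lia.
have [b' eb] : exists b', b = b' + 2 * y by exists (b - 2 * y); lia.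
have N3 : a + b <= 2 * K.+1 * a'.
  apply: leq_trans N1 _; rewrite -mulnA mulnCA leq_mul2l; apply/orP; right; lia.
have N4 : a + b <= 2 * K.+1 * b'.
  apply: leq_trans N2 _; rewrite -mulnA mulnCA leq_mul2l; apply/orP; right; lia.
have p1 : n0 <= a' by lia.
have p2 : n0 <= b' by lia.
have p3 : a' + 2 * x <= a + b by lia.
have p4 : b' + 2 * y <= a + b by lia.
have [h1 h2] := hn0 (a + b) a' b' (2 * x) (2 * y) p1 p2 p3 p4 N3 N4.
rewrite -ea -eb in h1 h2.
have cc := @card_confs_sub _ _ _ _ (@dir_gt0 (a + b)) a b z 2 (leq_addr _ _) (leq_addl _ _).
rewrite zx zy in cc.
have {}cc := cc (ltac:(lia)) (ltac:(lia)).
have eE : #|[set nu in V (a + b) a b | nu z < 2]| = #|V (a + b) a b| - #|V (a + b) a' b'|.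
  have -> : a' = a - 2 * x by lia.
  have -> : b' = b - 2 * y by lia.
  rewrite cc -(cardsID [set nu : conf (dirs (a + b)) (a + b) | 2 <= nu z] (V (a + b) a b)).
  rewrite [X in _ = X + _ - _](_ : _ = #|[set nu in V (a + b) a b | 2 <= nu z]|); last first.
    by apply: eq_card => nu; rewrite finset.in_setI !finset.in_set.
  rewrite addKn; apply: eq_card => nu.
  by rewrite finset.in_setD !finset.in_set -ltnNge andbC.
rewrite eE; have xy : 0 < 2 * x + 2 * y.
  by have := dir_gt0 z; rewrite zx zy; lia.
by rewrite -(leq_pmul2l xy) mulnA [_ * q]mulnC.
Qed.

(** The vectors (1, i + 2), (i + 3, 1) and their sum: disjoint triples for distinct
i, since a coordinate 1 and its position identify the first two vectors. *)
Definition farey_group N (i0 : dirs N) (i : nat) : group (dirs N) :=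
  (mkdir i0 1 i.+2, mkdir i0 i.+3 1, mkdir i0 i.+4 i.+3).

Lemma farey_groups N (i0 : dirs N) M : M.+4 <= N ->
  let gs := map (farey_group i0) (iota 0 M) in
  [/\ all (good_group (@dx N) (@dy N)) gs, uniq (flatten (map (@gpts (dirs N)) gs)) &
      forall i, i < M -> dx (gz (farey_group i0 i)) = i.+4 /\
                         dy (gz (farey_group i0 i)) = i.+3].
Proof.
move=> MN gs.
have gE i : i < M ->
    [/\ dx (gx (farey_group i0 i)) = 1 /\ dy (gx (farey_group i0 i)) = i.+2,
        dx (gy (farey_group i0 i)) = i.+3 /\ dy (gy (farey_group i0 i)) = 1 &
        dx (gz (farey_group i0 i)) = i.+4 /\ dy (gz (farey_group i0 i)) = i.+3].
  move=> iM; split; apply: mkdirE; rewrite ?coprime1n ?coprimen1 ?coprimeSn //; lia.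
have mem_gpts i p : i < M -> p \in gpts (farey_group i0 i) ->
    (dx p, dy p) \in [:: (1, i.+2); (i.+3, 1); (i.+4, i.+3)].
  move=> iM; have [[h1 h2] [h3 h4] [h5 h6]] := gE i iM.
  by rewrite !inE => /or3P[]/eqP->; rewrite ?h1 ?h2 ?h3 ?h4 ?h5 ?h6 eqxx ?orbT.
have ugpts i : i < M -> uniq (gpts (farey_group i0 i)).
  move=> iM; have [[h1 h2] [h3 h4] [h5 h6]] := gE i iM.
  rewrite /= !inE negb_or !andbT -andbA; apply/and3P; split; apply/eqP => e;
  by have := congr1 (@dx N) e; rewrite ?h1 ?h3 ?h5; lia.
split.
- apply/allP => g /mapP[i]; rewrite mem_iota add0n => /= iM ->.
  have [[h1 h2] [h3 h4] [h5 h6]] := gE i iM.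
  by rewrite /good_group ugpts // h1 h2 h3 h4 h5 h6 /= addn1 add1n !eqxx.
- rewrite /gs -map_comp.
  have : all (fun i => i < M) (iota 0 M).
    by apply/allP => i; rewrite mem_iota.
  have := iota_uniq 0 M; elim: (iota 0 M) => //= i s IH /andP[ins us] /andP[iM sM].
  rewrite (_ : [&& _, _, _ & _] =
    uniq (gpts (farey_group i0 i) ++ flatten [seq (@gpts _ \o farey_group i0) x | x <- s])) //.
  rewrite cat_uniq ugpts // IH // andbT /=; apply/hasPn => p /flatten_mapP[j js] /= pj.
  apply: contra ins => pi; suff -> : i = j by [].
  have := mem_gpts _ _ iM pi; have := mem_gpts _ _ (allP sM _ js) pj.
  move: (dx p) (dy p) => c d; rewrite !inE.
  by case/or3P => /eqP[-> ->]; case/or3P => /eqP[]; lia.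
- by move=> i iM; have [_ _] := gE i iM.
Qed.
Lemma rarely_lt2_farey (K q M : nat) : exists n0, forall a b,
  n0 <= a -> n0 <= b -> a <= K * b -> b <= K * a ->
  forall i0 : dirs (a + b), let gs := map (farey_group i0) (iota 0 M) in
  [/\ all (good_group (@dx (a + b)) (@dy (a + b))) gs,
      uniq (flatten (map (@gpts (dirs (a + b))) gs)) &
      q * (\sum_(g <- gs) #|[set nu in V (a + b) a b | nu (gz g) < 2]|)
        <= M * #|V (a + b) a b| ].
Proof.
have [n0 hn0] : exists n0, forall i, i < M -> forall a b,
    n0 <= a -> n0 <= b -> a <= K * b -> b <= K * a -> forall z : dirs (a + b),
    dx z = i.+4 -> dy z = i.+3 ->
    q * #|[set nu in V (a + b) a b | nu z < 2]| <= #|V (a + b) a b|.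
  elim: M => [|M [n1 IH]]; first by exists 0.
  have [n2 h2] := rarely_lt2 K q M.+4 M.+3; exists (maxn n1 n2) => i.
  rewrite ltnS leq_eqVlt => /predU1P[->|iM] a b; rewrite !geq_max.
    by move=> /andP[_ ha] /andP[_ hb]; exact: h2.
  by move=> /andP[ha _] /andP[hb _]; exact: IH.
exists (maxn n0 M.+4) => a b; rewrite !geq_max => /andP[ha Ma] /andP[hb _] aK bK i0 gs.
have [h1 h2 h3] := farey_groups i0 (leq_trans Ma (leq_addr b a)).
split=> //; rewrite /gs big_map big_distrr /=.
rewrite -[M in _ <= M * _](size_iota 0 M) -sum1_size big_distrl /=.
rewrite !big_seq; apply: leq_sum => i; rewrite mem_iota add0n => /= iM.
by have [zx zy] := h3 i iM; rewrite mul1n; exact: (hn0 i).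
Qed.

Lemma affinity_vanishes (R : realType) (r : R) (K : nat) (eps : R) :
  (0 < r)%R -> (r != 1)%R -> (0 < eps)%R -> exists n0, forall a b,
  n0 <= a -> n0 <= b -> a <= K * b -> b <= K * a ->
  (\sum_(nu in V (a + b) a b) Num.sqrt (conf_weight r nu)
    <= eps * Num.sqrt #|V (a + b) a b|%:R
         * Num.sqrt (\sum_(nu in V (a + b) a b) conf_weight r nu))%R.
Proof.
move=> r0 r1 e0; have [t /andP[t0 t1] spread] := group_spread r0 r1.
have rho1 : (`|Num.sqrt t| < 1)%R.
  by rewrite ger0_norm ?sqrtr_ge0 // -sqrtr1 ltr_sqrt.
have e20 : (0 < eps / 2)%R by rewrite divr_gt0.
have /cvgrPdist_lt/(_ _ e20)[M0 _ hM0] := cvg_expr rho1.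
pose M := M0.+1; have {hM0} := hM0 M (leqnSn M0).
rewrite /= sub0r normrN ger0_norm ?exprn_ge0 ?sqrtr_ge0 // => hM.
pose q := Num.bound (4 * M%:R / eps ^+ 2 : R)%R.
have hq : (4 * M%:R / eps ^+ 2 < q%:R :> R)%R.
  by rewrite archi_boundP // divr_ge0 ?sqr_ge0 // mulr_ge0.
have [n0 hn0] := rarely_lt2_farey K q M; exists (maxn n0 1) => a b.
rewrite !geq_max => /andP[ha a1] /andP[hb _] aK bK.
have [e _] := ex_dir (isT : coprime 1 0) (leq_trans a1 (leq_addr b a)) (leq0n (a + b)).
have [g1 g2 hbad] := hn0 a b ha hb aK bK e.
have := confs_affinity (@dir_gt0 (a + b)) (leq_addr b a) (leq_addl a b) r0 t0 spread g1 g2.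
rewrite size_map size_iota; move: hbad; set bad := \sum_(g <- _) _ => hbad haff.
apply: (le_trans haff); rewrite ler_wpM2r ?sqrtr_ge0 //.
have -> : (eps = eps / 2 + eps / 2)%R by rewrite -splitr.
rewrite mulrDl; apply: lerD; first by rewrite ler_wpM2r ?sqrtr_ge0 // ltW.
have -> : (eps / 2 = Num.sqrt ((eps / 2) ^+ 2))%R by rewrite sqrtr_sqr ger0_norm // ltW.
have e2W : (0 <= (eps / 2) ^+ 2 * #|V (a + b) a b|%:R)%R by rewrite mulr_ge0 // sqr_ge0.
rewrite -sqrtrM ?sqr_ge0 // ler_sqrt //.
move: hbad; rewrite -(ler_nat R) !natrM.
have M1 : (0 < M%:R :> R)%R by rewrite ltr0n.
have bad0 : (0 <= bad%:R :> R)%R by [].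
move: (bad%:R : R)%R bad0 (#|V (a + b) a b|%:R : R)%R (M%:R : R)%R (q%:R : R)%R M1 hq.
move=> B B0 W m Q m0; rewrite ltr_pdivrMr ?exprn_gt0 // => hq h.
rewrite -(ler_pM2l m0); apply: (@le_trans _ _ (B * (Q * eps ^+ 2) / 4)%R).
  by have := ler_wpM2l B0 (ltW hq); lra.
have := ler_wpM2r (sqr_ge0 eps) h; rewrite expr_div_n; lra.
Qed.

End Core.
(** * Lines as configurations *)

Section Walks.
Local Open Scope nat_scope.

(** A piece is a primitive vector together with the number of times it is used. *)
Definition step (P : lpoint) (p : lpoint * nat) : lpoint :=
  (P.1 + p.2 * p.1.1, P.2 + p.2 * p.1.2).

Fixpoint walk (P : lpoint) (s : seq (lpoint * nat)) : seq lpoint :=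
  P :: if s is p :: s' then walk (step P p) s' else [::].

Definition wf_piece (p : lpoint * nat) := coprime p.1.1 p.1.2 && (0 < p.2).

Lemma edges_walk P p s :
  edges (walk P (p :: s)) = (P, step P p) :: edges (walk (step P p) s).
Proof. by case: s. Qed.

Lemma head_walk P0 P s : head P0 (walk P s) = P.
Proof. by case: s. Qed.

Lemma last_walk P0 P s : last P0 (walk P s) =
  (P.1 + \sum_(p <- s) p.2 * p.1.1, P.2 + \sum_(p <- s) p.2 * p.1.2).
Proof.
elim: s P0 P => [|p s IH] P0 P /=; first by rewrite !big_nil !addn0; case: P.
by rewrite IH !big_cons /= !addnA.
Qed.

Lemma step_inj P p q : wf_piece p -> wf_piece q -> step P p = step P q -> p = q.
Proof.
case: p q => [[a b] k] [[c d] l] /andP[/= cab k0] /andP[/= ccd l0].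
case=> /addnI h1 /addnI h2.
have gk x y m : coprime x y -> gcdn (m * x) (m * y) = m.
  by move=> /eqP cxy; rewrite -muln_gcdr cxy muln1.
have kl : k = l by rewrite -(gk _ _ k cab) h1 h2 gk.
by move: h1 h2; rewrite kl => /eqP + /eqP; rewrite !eqn_pmul2l // => /eqP-> /eqP->.
Qed.

Lemma walk_inj P s s' : all wf_piece s -> all wf_piece s' ->
  walk P s = walk P s' -> s = s'.
Proof.
elim: s s' P => [|p s IH] [|q s'] P //=; try by case: s; case: s'.
  by move=> _ _; case; case: (s').
  by move=> _ _; case; case: (s).
move=> /andP[wp ws] /andP[wq ws'] [h].
have hpq : step P p = step P q.
  by have := congr1 (head P) h; rewrite !head_walk.
have pq := step_inj wp wq hpq.
by rewrite pq; congr cons; apply: (IH _ (step P p)) => //; rewrite h pq.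
Qed.

End Walks.

Section Angles.
Local Open Scope ring_scope.
Variable R : realType.

(** The inclination of an edge with direction x, with no case distinction because
the coordinates of x are nonnegative. *)
Definition ang (x : lpoint) : R :=
  acos (x.1%:R / Num.sqrt (x.1%:R ^+ 2 + x.2%:R ^+ 2)).

Lemma cos_ang_bounds (x : lpoint) : coprime x.1 x.2 ->
  [/\ 0 < x.1%:R ^+ 2 + x.2%:R ^+ 2 :> R,
      0 <= x.1%:R / Num.sqrt (x.1%:R ^+ 2 + x.2%:R ^+ 2) :> R &
      x.1%:R / Num.sqrt (x.1%:R ^+ 2 + x.2%:R ^+ 2) <= 1 :> R].
Proof.
case: x => a b /= cab.
have p0 : 0 < a%:R ^+ 2 + b%:R ^+ 2 :> R.
  rewrite -!natrX -natrD ltr0n addn_gt0 !expn_gt0 !orbF.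
  by case: a b cab => [|a] [|b].
split=> //.
rewrite ler_pdivrMr ?sqrtr_gt0 // mul1r -[leLHS]ger0_norm // -sqrtr_sqr.
by rewrite ler_sqrt ?lerDl ?sqr_ge0 // ltW.
Qed.

Lemma inclination_step P p : wf_piece p ->
  inclination R (P, step P p) = ang p.1.
Proof.
case: p P => [[a b] k] [c d] /andP[/= cab k0]; rewrite /inclination /ang /=.
rewrite !natrD !natrM ![_ + _ - _]addrAC !subrr !add0r.
have [p0 _ _] := cos_ang_bounds (x := (a, b)) cab.
have kR : 0 < k%:R :> R by rewrite ltr0n.
rewrite mulr_ge0 // !exprMn -mulrDr sqrtrM ?sqr_ge0 // sqrtr_sqr ger0_norm //.
by rewrite -mulf_div divff ?mul1r // gt_eqF.
Qed.

Lemma ang_bounds (x : lpoint) : coprime x.1 x.2 -> 0 <= ang x <= pi / 2.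
Proof.
move=> /cos_ang_bounds[_ h1 h2].
have bnd (z : R) : 0 <= z -> z <= 1 -> -1 <= z <= 1.
  by move=> z0 ->; rewrite andbT (le_trans _ z0) // lerN10.
have h3 := bnd _ h1 h2.
rewrite /ang acos_ge0 //= leNgt; apply/negP => h4.
have : cos (ang x) < cos (pi / 2) :> R.
  rewrite ltr_cos // in_itv /= ?acos_ge0 ?acos_lepi // divr_ge0 ?pi_ge0 //=.
  by rewrite ler_pdivrMr // ler_peMr ?pi_ge0 // ler1n.
by rewrite acosK ?in_itv //= cos_pihalf ltNge h1.
Qed.

(** Equal cosines give proportional vectors, after squaring. *)
Lemma ang_inj (x y : lpoint) : coprime x.1 x.2 -> coprime y.1 y.2 ->
  ang x = ang y -> x = y.
Proof.
move=> cx cy.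
have [px x0 x1] := cos_ang_bounds cx; have [py y0 y1] := cos_ang_bounds cy.
have bnd (z : R) : 0 <= z -> z <= 1 -> z \in `[(-1), 1].
  by move=> z0 z1; rewrite in_itv /= z1 andbT (le_trans _ z0) // lerN10.
move=> /(congr1 cos); rewrite !acosK ?bnd //.
have nz z : 0 < z -> Num.sqrt z != 0 :> R by move=> z0; rewrite gt_eqF ?sqrtr_gt0.
move=> /eqP; rewrite eqr_div ?nz // => /eqP.
move=> /(congr1 (fun z => z ^+ 2)); rewrite !exprMn !sqr_sqrtr ?(ltW px) ?(ltW py) //.
rewrite !mulrDr [y.1%:R ^+ 2 * x.1%:R ^+ 2]mulrC => /addrI.
rewrite -!natrX -!natrM => /eqP; rewrite eqr_nat -!expnMn eqn_exp2r // => /eqP e.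
case: x y cx cy e {px x0 x1 py y0 y1} => [a b] [c d] /= cab ccd e.
have ac : a = c.
  apply/eqP; rewrite eqn_dvd -(Gauss_dvdl c cab) -e dvdn_mulr //=.
  by rewrite -(Gauss_dvdl a ccd) e dvdn_mulr.
move: e cab ccd; rewrite -ac; case: a {ac} => [|a] e.
  by rewrite /coprime !gcd0n => /eqP-> /eqP->.
by move/eqP: e; rewrite eqn_pmul2l // => /eqP->.
Qed.

Lemma inclinations_walk P s : all wf_piece s ->
  [seq inclination R e | e <- edges (walk P s)] = [seq ang p.1 | p <- s].
Proof.
elim: s P => [|p s IH] P //= /andP[wp ws].
by rewrite -/(walk P (p :: s)) edges_walk /= inclination_step // IH.
Qed.

(** The lattice points of the edge after its left endpoint P are P + j x for j from
1 to p.2, as x is primitive. *)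
Lemma edge_count_step P p : wf_piece p -> edge_count R (P, step P p) = p.2.
Proof.
case: p P => [[a b] k] [c d] /andP[/= cab k0]; rewrite /edge_count.
apply: card_fset_set.
pose f (j : nat) : lpoint := ((c + j.+1 * a)%N, (d + j.+1 * b)%N).
have finj : injective f.
  move=> i j; case: a b cab @f => [|a] [|b] //= cab [].
  - by move=> _ /addnI /eqP; rewrite eqn_mul2r /= eqSS => /eqP.
  - by move=> /addnI /eqP; rewrite eqn_mul2r /= eqSS => /eqP.
  - by move=> /addnI /eqP; rewrite eqn_mul2r /= eqSS => /eqP.
have -> : ([set z | on_segment R ((c, d), step (c, d) ((a, b), k)) z /\ z <> (c, d)]
   = f @` `I_k)%classic.
  apply/seteqP; split => [[zx zy] [[t [/andP[t0 t1] /= ex ey]] zP]|z [j /= jk <-]].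
    have {}ex : zx%:R = c%:R + t * (k%:R * a%:R) :> R by rewrite ex natrD natrM; ring.
    have {}ey : zy%:R = d%:R + t * (k%:R * b%:R) :> R by rewrite ey natrD natrM; ring.
    have ta0 : 0 <= t * (k%:R * a%:R) by rewrite !mulr_ge0.
    have tb0 : 0 <= t * (k%:R * b%:R) by rewrite !mulr_ge0.
    have czx : (c <= zx)%N by rewrite -(ler_nat R) ex lerDl.
    have dzy : (d <= zy)%N by rewrite -(ler_nat R) ey lerDl.
    have [u eu] : exists u, zx = (c + u)%N by exists (zx - c)%N; rewrite subnKC.
    have [v ev] : exists v, zy = (d + v)%N by exists (zy - d)%N; rewrite subnKC.
    move: ex ey; rewrite eu ev !natrD => /addrI hu /addrI hv.
    have [j [ju jv]] : exists j, u = (j * a)%N /\ v = (j * b)%N.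
      have uv : (u * b = v * a)%N.
        by apply/eqP; rewrite -(eqr_nat R) !natrM hu hv; apply/eqP; ring.
      have [a0|a0] := posnP a.
        move: cab hu; rewrite a0 /coprime gcd0n => /eqP-> /eqP.
        by rewrite !mulr0 pnatr_eq0 => /eqP->; exists v; rewrite muln0 muln1.
      have /dvdnP[j uj] : (a %| u)%N by rewrite -(Gauss_dvdl u cab) uv dvdn_mull.
      exists j; split=> //; apply/eqP; rewrite -(eqn_pmul2r a0) -uv uj.
      by rewrite mulnAC.
    have ab0 : (0 < a + b)%N by case: a b cab {f finj eu ev hu hv ju jv ta0 tb0} => [|a] [|b].
    have jt : j%:R = t * k%:R :> R.
      have abR : (a + b)%:R != 0 :> R by rewrite pnatr_eq0 -lt0n.
      apply: (mulIf abR); rewrite natrD mulrDr -!natrM -ju -jv hu hv; ring.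
    have jk : (j <= k)%N by rewrite -(ler_nat R) jt ler_piMl.
    case: j ju jv jt jk => [|j] ju jv _ jk.
      by case: zP; rewrite eu ev ju jv !mul0n !addn0.
    by exists j => //; rewrite /f ju jv.
  split; last first.
    rewrite /f => -[] /eqP; rewrite -[X in _ == X]addn0 eqn_add2l => ha /eqP.
    rewrite -[X in _ == X]addn0 eqn_add2l => hb.
    by move: cab ha hb; rewrite !muln_eq0 /=; case: (a) => [|?] //; case: (b).
  have k0R : k%:R != 0 :> R by rewrite pnatr_eq0 -lt0n.
  exists (j.+1%:R / k%:R); split.
  - by rewrite divr_ge0 //= ler_pdivrMr ?ltr0n // mul1r ler_nat.
  - rewrite /f /step /=; move: (j.+1) => J; rewrite !natrD !natrM.
    by move: (J%:R : R) (k%:R : R) k0R => x y y0; field.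
  - rewrite /f /step /=; move: (j.+1) => J; rewrite !natrD !natrM.
    by move: (J%:R : R) (k%:R : R) k0R => x y y0; field.
by apply: inj_card_eq => i j _ _; exact: finj.
Qed.

End Angles.
Section Coding.
Variable R : realType.
Local Open Scope ring_scope.

(** The difference of consecutive vertices is split as its gcd times a primitive
vector. *)
Lemma walk_of_line P G :
  {in edges (P :: G), forall e, e.1 != e.2} ->
  {in edges (P :: G), forall e, 0 <= inclination R e <= pi / 2} ->
  exists2 s, all wf_piece s & P :: G = walk P s.
Proof.
elim: G P => [|Q G IH] P ne rg; first by exists [::].
have [||s ws eG] := IH Q.
- by move=> e eG; apply: ne; rewrite inE eG orbT.
- by move=> e eG; apply: rg; rewrite inE eG orbT.
have /andP[h1 h2] := inclination_mono (ne (P, Q) (mem_head _ _)) (rg (P, Q) (mem_head _ _)).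
have nPQ := ne (P, Q) (mem_head _ _).
case: P Q {IH ne rg} h1 h2 nPQ eG => [a b] [c d] /= ac bd nPQ eG.
pose g := gcdn (c - a) (d - b).
have g0 : (0 < g)%N.
  rewrite gcdn_gt0 !subn_gt0 !ltn_neqAle ac bd !andbT -negb_and.
  by apply: contra nPQ => /andP[/eqP-> /eqP->].
pose p : lpoint * nat := (((c - a) %/ g, (d - b) %/ g)%N, g).
have stepE : step (a, b) p = (c, d).
  rewrite /step /p /= ![(g * _)%N]mulnC !divnK ?dvdn_gcdl ?dvdn_gcdr //.
  by rewrite !subnKC.
exists (p :: s); last by rewrite /= -/(walk _ _) stepE -eG.
rewrite /= ws andbT /wf_piece /= g0 andbT /coprime.
rewrite -(eqn_pmul2r g0) mul1n muln_gcdl !divnK ?dvdn_gcdl ?dvdn_gcdr //.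
Qed.

Lemma line_walkP G n :
  Pi R n G <-> exists s, [/\ all wf_piece s, sorted <%R [seq ang R p.1 | p <- s],
    (\sum_(p <- s) p.2 * p.1.1)%N = n.1 /\ (\sum_(p <- s) p.2 * p.1.2)%N = n.2 &
    G = walk origin s].
Proof.
split.
  case: G => [|P G] [[]] //= [->] ne rg srt hn.
  have [s ws eG] := walk_of_line ne rg; exists s; split=> //.
    by rewrite -(inclinations_walk R origin ws) -eG.
  have := last_walk origin origin s; rewrite -eG /= hn => ->.
  by rewrite !add0n.
move=> [s [ws srt [n1 n2] ->]]; split; last first.
  by rewrite last_walk n1 n2 !add0n; case: n {n1 n2}.
split.
- by case: (s).
- clear srt n1 n2; elim: s origin ws => [|p s IH] P //= /andP[wp ws].
  rewrite -/(walk P (p :: s)) edges_walk => e; rewrite inE => /predU1P[->|]; last exact: IH.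
  case: p P wp => [[a b] k] [c d] /andP[/= cab k0]; rewrite /step /= xpair_eqE.
  have e0 x y : (x == (x + y)%N) = (y == 0%N).
    by rewrite -{1}[x]addn0 eqn_add2l eq_sym.
  rewrite !e0 !muln_eq0 eqn0Ngt k0 /=.
  by case: a b cab => [|a] [|b].
- move=> e /(map_f (inclination R)); rewrite inclinations_walk // => /mapP[p ps ->].
  by apply: ang_bounds; have /andP[] := allP ws p ps.
- by rewrite inclinations_walk.
Qed.

Section Box.
Variable N : nat.

Definition dirpt (i : dirs N) : lpoint := (dx i, dy i).

Definition sorted_dirs : seq (dirs N) :=
  sort (fun i j => ang R (dirpt i) <= ang R (dirpt j)) (enum {: dirs N}).

(** The pieces of a configuration in the order of increasing angle. *)
Definition code (nu : conf (dirs N) N) : seq (lpoint * nat) :=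
  [seq (dirpt i, nat_of_ord (nu i)) | i <- sorted_dirs & (0 < nu i)%N].

Definition line (nu : conf (dirs N) N) : seq lpoint := walk origin (code nu).

Lemma dirpt_inj : injective dirpt.
Proof. by move=> i j [h1 h2]; exact: dir_inj. Qed.

Lemma mem_sorted_dirs i : i \in sorted_dirs.
Proof. by rewrite mem_sort mem_enum. Qed.

Lemma sorted_dirs_lt :
  sorted (fun i j => ang R (dirpt i) < ang R (dirpt j)) sorted_dirs.
Proof.
rewrite -(@sorted_map _ _ (fun i => ang R (dirpt i)) <%R) lt_sorted_uniq_le.
apply/andP; split.
  rewrite map_inj_uniq ?sort_uniq ?enum_uniq // => i j aij.
  by apply: dirpt_inj; apply: ang_inj aij; exact: dir_coprime.
by rewrite sorted_map; apply: sort_sorted => i j; exact: le_total.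
Qed.

Lemma code_wf nu : all wf_piece (code nu).
Proof.
apply/allP => p /mapP[i]; rewrite mem_filter => /andP[nui _] ->.
by rewrite /wf_piece nui andbT; exact: dir_coprime.
Qed.

Lemma code_sorted nu : sorted <%R [seq ang R p.1 | p <- code nu].
Proof.
rewrite -map_comp sorted_map; apply: sorted_filter; last exact: sorted_dirs_lt.
by move=> i j k; exact: lt_trans.
Qed.

(** Directions of multiplicity 0 contribute the neutral element to the right-hand
side, so it agrees with the operation over the pieces of the line. *)
Lemma big_code (T : Type) (idx : T) (op : Monoid.com_law idx) (F : lpoint -> nat -> T) nu :
  (forall x, F x 0%N = idx) ->
  \big[op/idx]_(p <- code nu) F p.1 p.2 = \big[op/idx]_i F (dirpt i) (nu i).
Proof.
move=> F0; rewrite /code big_map big_filter /=.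
rewrite (perm_big _ (permEl (perm_sort _ _))) /= big_enum_cond /= big_mkcond.
by apply: eq_bigr => i _; case: posnP => // ->; rewrite F0.
Qed.

Lemma mem_code i (nu : conf (dirs N) N) : (0 < nu i)%N -> (dirpt i, nat_of_ord (nu i)) \in code nu.
Proof.
by move=> h; apply/mapP; exists i => //; rewrite mem_filter h mem_sorted_dirs.
Qed.

Lemma code_inj : injective code.
Proof.
have half nu mu i : code nu = code mu -> (0 < nu i)%N -> nu i = mu i :> nat.
  move=> e /mem_code; rewrite e => /mapP[j _ [h1 h2 ->]].
  by rewrite (dir_inj h1 h2).
move=> nu mu e; apply/ffunP => i; apply: val_inj => /=.
have [n0|n0] := posnP (nu i); last exact: half.
have [m0|m0] := posnP (mu i); first by rewrite n0 m0.
by rewrite (half mu nu).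
Qed.

Lemma line_inj : injective line.
Proof. by move=> nu mu /(walk_inj (code_wf _) (code_wf _)); exact: code_inj. Qed.

Fixpoint lookup (s : seq (lpoint * nat)) (x : lpoint) : nat :=
  if s is p :: s' then if p.1 == x then p.2 else lookup s' x else 0.

Lemma lookup_mem s x : (0 < lookup s x)%N -> (x, lookup s x) \in s.
Proof.
elim: s => //= p s IH; case: eqP => [<-|_] h; first by rewrite -surjective_pairing mem_head.
by rewrite inE IH // orbT.
Qed.

Lemma lookup_eq s p : uniq (map fst s) -> p \in s -> lookup s p.1 = p.2.
Proof.
elim: s => //= q s IH /andP[qs us]; rewrite inE => /predU1P[->|ps]; first by rewrite eqxx.
case: eqP => [e|_]; last exact: IH.
by case/negP: qs; rewrite e; apply: map_f.
Qed.

(** Two lists with the same elements that are strictly sorted by angle are equal, so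
the multiplicities recover the list. *)
Lemma code_surj s : all wf_piece s -> sorted <%R [seq ang R p.1 | p <- s] ->
  (\sum_(p <- s) p.2 * p.1.1 <= N)%N -> (\sum_(p <- s) p.2 * p.1.2 <= N)%N ->
  exists nu, code nu = s.
Proof.
move=> ws srt sN1 sN2.
have us : uniq (map fst s).
  move: srt; rewrite lt_sorted_uniq_le => /andP[+ _].
  by rewrite (map_comp (ang R) fst); exact: map_uniq.
have bnd p : p \in s -> [/\ (p.2 <= N)%N, (p.1.1 <= N)%N & (p.1.2 <= N)%N].
  move=> ps; have /andP[cp p0] := allP ws p ps.
  have b1 : (p.2 * p.1.1 <= N)%N.
    by apply: leq_trans sN1; rewrite (big_rem _ ps) /= leq_addr.
  have b2 : (p.2 * p.1.2 <= N)%N.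
    by apply: leq_trans sN2; rewrite (big_rem _ ps) /= leq_addr.
  split.
  - case: (posnP p.1.1) => [z|z]; last by apply: leq_trans b1; rewrite leq_pmulr.
    by move: cp b2; rewrite z /coprime gcd0n => /eqP->; rewrite muln1.
  - by apply: leq_trans b1; rewrite leq_pmull.
  - by apply: leq_trans b2; rewrite leq_pmull.
pose nu : conf (dirs N) N := [ffun i => inord (lookup s (dirpt i))].
have nuE i : nu i = lookup s (dirpt i) :> nat.
  rewrite ffunE inordK // ltnS; case: (posnP (lookup s (dirpt i))) => [->//|].
  by move=> /lookup_mem/bnd[].
exists nu.
(* Both lists are strictly sorted for lt2, so it remains to compare members. *)
pose lt2 := [rel p q : lpoint * nat | ang R p.1 < ang R q.1].
have lt2_tr : transitive lt2 by move=> p q t /=; exact: lt_trans.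
have lt2_irr : irreflexive lt2 by move=> p /=; rewrite ltxx.
apply: (irr_sorted_eq lt2_tr lt2_irr).
- by have := code_sorted nu; rewrite sorted_map.
- by move: srt; rewrite sorted_map.
move=> p; apply/mapP/idP => [[i]|ps].
  by rewrite mem_filter nuE => /andP[/lookup_mem h _] ->.
have /andP[cp p0] := allP ws p ps; have [h1 h2 h3] := bnd p ps.
have [i [ix iy]] := ex_dir cp h2 h3.
have ip : dirpt i = p.1 by rewrite /dirpt ix iy; case: (p.1).
exists i; last by rewrite nuE ip lookup_eq //; case: (p).
by rewrite mem_filter nuE ip lookup_eq // p0 mem_sorted_dirs.
Qed.

End Box.

Lemma line_bij (a b : nat) :
  set_bij [set` confs (@dx (a + b)) (@dy (a + b)) (a + b) a b]%classic
    (Pi R (a, b)) (@line (a + b)).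
Proof.
have tx (nu : conf (dirs (a + b)) (a + b)) :
    (\sum_(p <- code nu) p.2 * p.1.1)%N = total (@dx (a + b)) (fun i => nu i).
  exact: (@big_code _ _ 0%N addn (fun x k => (k * x.1)%N)).
have ty (nu : conf (dirs (a + b)) (a + b)) :
    (\sum_(p <- code nu) p.2 * p.1.2)%N = total (@dy (a + b)) (fun i => nu i).
  exact: (@big_code _ _ 0%N addn (fun x k => (k * x.2)%N)).
split.
- move=> nu /= /confsP[ha hb]; apply/line_walkP; exists (code nu).
  by split; [exact: code_wf | exact: code_sorted | rewrite tx ty |].
- by move=> nu mu _ _; exact: line_inj.
- move=> G /line_walkP[s [ws srt [/= h1 h2] ->]].
  have [||nu cnu] := @code_surj (a + b) s ws srt.
  + by rewrite h1 leq_addr.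
  + by rewrite h2 leq_addl.
  exists nu; last by rewrite /line cnu.
  by apply/confsP; rewrite -tx -ty cnu.
Qed.

Lemma bweight_line (r : R) N (nu : conf (dirs N) N) :
  bweight r (line nu) = conf_weight r nu.
Proof.
rewrite /conf_weight -(@big_code _ _ 1 *%R (fun _ k => bcoef r k)); last first.
  by move=> x; rewrite bcoef0.
rewrite /bweight /line; have := code_wf nu.
elim: (code nu) origin => [|p s IH] P /=; first by rewrite !big_nil.
move=> /andP[wp ws]; rewrite -/(walk P (p :: s)) edges_walk !big_cons IH //.
by rewrite edge_count_step.
Qed.

Lemma fsum_line (a b : nat) (F : seq lpoint -> R) :
  \sum_(G \in Pi R (a, b)) F G
   = \sum_(nu in confs (@dx (a + b)) (@dy (a + b)) (a + b) a b) F (line nu).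
Proof.
pose V := confs (@dx (a + b)) (@dy (a + b)) (a + b) a b.
have := @reindex_fsbig _ 0 +%R {ffun dirs (a + b) -> 'I_(a + b).+1} (seq lpoint)
  (@line (a + b)) [set` V]%classic (Pi R (a, b)) F (line_bij a b).
move=> ->; have fV : finite_set [set` V]%classic by exact: finite_finset.
rewrite (fsbig_finite _ _ fV) -[RHS]big_enum; apply: perm_big.
apply: uniq_perm; rewrite ?enum_uniq // => nu.
by rewrite in_fset_set // mem_enum; apply/idP/idP; rewrite inE.
Qed.

End Coding.
(** * Total variation *)

Section TotalVariation.
Local Open Scope classical_set_scope.
Local Open Scope ring_scope.
Variable R : realType.

(** Where q <= p one has q <= sqrt (p * q), and elsewhere p <= sqrt (p * q). *)
Lemma affinity_gap (T : finType) (V : {set T}) (p q : T -> R) :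
  (forall x, 0 <= p x) -> (forall x, 0 <= q x) -> \sum_(x in V) p x = 1 ->
  1 - \sum_(x in V) Num.sqrt (p x * q x)
    <= \sum_(x in V | q x <= p x) p x - \sum_(x in V | q x <= p x) q x.
Proof.
move=> p0 q0 p1; rewrite -{1}p1 -!sumrB [leRHS]big_mkcondr.
apply: ler_sum => x _; case: (lerP (q x) (p x)) => [qp|pq].
  rewrite lerD2l lerN2 -[leLHS]ger0_norm // -sqrtr_sqr ler_sqrt ?mulr_ge0 //.
  by rewrite expr2 ler_wpM2r.
rewrite subr_le0 -[leLHS]ger0_norm // -sqrtr_sqr ler_sqrt ?mulr_ge0 //.
by rewrite expr2 ler_wpM2l // ltW.
Qed.

Variables (r : R) (a b : nat).
Hypotheses (r_gt0 : 0 < r) (a_gt0 : (0 < a)%N) (b_gt0 : (0 < b)%N).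
Notation V := (confs (@dx (a + b)) (@dy (a + b)) (a + b) a b).

Definition conf_prob (s : R) (nu : conf (dirs (a + b)) (a + b)) : R :=
  conf_weight s nu / \sum_(mu in V) conf_weight s mu.

Lemma conf_prob_ge0 s nu : 0 < s -> 0 <= conf_prob s nu.
Proof.
move=> s0; have h mu : 0 <= conf_weight s mu :> R.
  by apply: prodr_ge0 => i _; exact/ltW/bcoef_gt0.
by rewrite divr_ge0 ?sumr_ge0.
Qed.

Lemma partition_gt0 s : 0 < s -> 0 < \sum_(mu in V) conf_weight s mu :> R.
Proof.
move=> s0; have h mu : 0 < conf_weight s mu :> R.
  by apply: prodr_gt0 => i _; exact: bcoef_gt0.
have : (0 < #|V|)%N.
  by apply: leq_trans (@confs_lower_bound (a + b) a b 1 _ _ _ _ _);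
    rewrite ?leq_addr ?leq_addl ?exp1n.
case/card_gt0P => mu muV; rewrite (bigD1 mu) //= ltr_pwDl //.
by apply: sumr_ge0 => *; exact: ltW.
Qed.

Lemma sum_conf_prob s : 0 < s -> \sum_(nu in V) conf_prob s nu = 1.
Proof.
by move=> s0; rewrite -mulr_suml divff // gt_eqF ?partition_gt0.
Qed.

Lemma Pmeas_line s (A : set (seq lpoint)) : A `<=` Pi R (a, b) ->
  Pmeas s (a, b) A = \sum_(nu in V | @line R _ nu \in A) conf_prob s nu.
Proof.
move=> AD; have -> : A = Pi R (a, b) `&` A by apply/esym/setIidPr.
rewrite /Pmeas fsbig_mkcondr fsum_line [RHS]big_mkcondr /=.
apply: eq_bigr => nu nuV.
have nuD : @line R _ nu \in Pi R (a, b).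
  by rewrite inE; have [h _ _] := @line_bij R a b; apply: h.
rewrite in_setI nuD /=; case: ifP => // _.
rewrite /Pmass /conf_prob fsum_line bweight_line; congr (_ / _).
by apply: eq_bigr => mu _; rewrite bweight_line.
Qed.

Lemma conf_weight1 N (nu : conf (dirs N) N) : conf_weight (1 : R) nu = 1.
Proof.
apply: big1 => i _; elim: (nat_of_ord _) => [|k IH]; first exact: bcoef0.
by rewrite bcoefS IH mul1r nat1r divff // pnatr_eq0.
Qed.

(** The event on which conf_prob r is at least conf_prob 1 realizes the lower
bound. *)
Lemma tv_dist_bounds (eps : R) :
  \sum_(nu in V) Num.sqrt (conf_weight r nu)
    <= eps * Num.sqrt #|V|%:R * Num.sqrt (\sum_(nu in V) conf_weight r nu) ->
  1 - eps <= tv_dist (Pi R (a, b)) (Pmeas r (a, b)) (Pmeas 1 (a, b)) <= 1.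
Proof.
move=> haff; rewrite /tv_dist; set S := [set _ | _ in _].
have ub : ubound S 1.
  move=> _ [A /= AD <-]; rewrite !Pmeas_line //.
  have bnd s : 0 < s -> 0 <= \sum_(nu in V | @line R _ nu \in A) conf_prob s nu <= 1.
    move=> s0; apply/andP; split; first by apply: sumr_ge0 => *; exact: conf_prob_ge0.
    rewrite -(sum_conf_prob s0) [leRHS](bigID (fun nu => @line R _ nu \in A)) /=.
    by rewrite lerDl sumr_ge0 // => *; exact: conf_prob_ge0.
  have := bnd r r_gt0; have := bnd 1 ltr01.
  by rewrite ler_norml; lra.
have S0 : S !=set0 by exists `|Pmeas r (a, b) set0 - Pmeas 1 (a, b) set0|, set0.
apply/andP; split; last exact: ge_sup.
pose A := [set G | exists2 nu, nu \in V &
             G = @line R _ nu /\ conf_prob 1 nu <= conf_prob r nu].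
have AD : A `<=` Pi R (a, b).
  by move=> _ [nu nuV [-> _]]; have [h _ _] := @line_bij R a b; apply: h.
have memA nu : nu \in V -> (@line R _ nu \in A) = (conf_prob 1 nu <= conf_prob r nu).
  move=> nuV; apply/idP/idP; last by move=> h; rewrite inE; exists nu.
  by rewrite inE => -[mu _ [/line_inj-> ]].
apply: (@le_trans _ _ `|Pmeas r (a, b) A - Pmeas 1 (a, b) A|); last first.
  by apply: ub_le_sup; [exists 1 | exists A].
apply: (le_trans _ (ler_norm _)); rewrite !Pmeas_line //.
have eA s : \sum_(nu in V | @line R _ nu \in A) conf_prob s nu
          = \sum_(nu in V | conf_prob 1 nu <= conf_prob r nu) conf_prob s nu.
  by apply: eq_bigl => nu; case: (boolP (nu \in V)) => //= nuV; rewrite memA.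
rewrite !eA; apply: (le_trans _ (@affinity_gap _ V (conf_prob r) (conf_prob 1) _ _ _)).
- rewrite lerD2l lerN2.
  have Zr := partition_gt0 r_gt0.
  have Z1 : 0 < #|V|%:R :> R.
    have := partition_gt0 ltr01; under eq_bigr do rewrite conf_weight1.
    by rewrite sumr_const.
  have e nu : Num.sqrt (conf_prob r nu * conf_prob 1 nu)
      = Num.sqrt (conf_weight r nu) / (Num.sqrt #|V|%:R * Num.sqrt (\sum_(mu in V) conf_weight r mu)).
    rewrite /conf_prob conf_weight1; under [X in _ * (1 / X)]eq_bigr do rewrite conf_weight1.
    rewrite sumr_const mul1r -mulrA sqrtrM; last first.
      by apply: prodr_ge0 => i _; exact/ltW/bcoef_gt0.
    by rewrite -invfM sqrtrV ?mulr_ge0 ?(ltW Zr) // sqrtrM ?(ltW Zr) // [X in _ / X]mulrC.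
  under eq_bigr do rewrite e.
  by rewrite -mulr_suml ler_pdivrMr ?mulr_gt0 ?sqrtr_gt0 // mulrA.
- by move=> nu; exact: conf_prob_ge0.
- by move=> nu; exact: conf_prob_ge0.
- exact: sum_conf_prob.
Qed.

End TotalVariation.

Local Open Scope classical_set_scope.
Local Open Scope ring_scope.

Lemma lim_tv_dist (R : realType) (r : R) : 0 < r -> r != 1 ->
  lim_balanced (fun n => tv_dist (Pi R n) (Pmeas r n) (Pmeas 1 n)) 1.
Proof.
move=> r0 r1 c C c0; apply/cvgrPdist_lt => e e0.
pose K := maxn (Num.bound (`|C|)) (Num.bound c^-1).
have CK : C <= K%:R.
  apply: (le_trans (ler_norm C)); apply: ltW; apply: (lt_le_trans (archi_boundP _)) => //.
  by rewrite ler_nat leq_maxl.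
have cK : c^-1 <= K%:R.
  apply: ltW; apply: (lt_le_trans (archi_boundP _)); first by rewrite invr_ge0 ltW.
  by rewrite ler_nat leq_maxr.
have e20 : 0 < e / 2 by rewrite divr_gt0.
have [n0 hn0] := affinity_vanishes K r0 r1 e20.
exists ([set n | (maxn n0 1 <= n)%N], [set n | (maxn n0 1 <= n)%N]).
  by split; exists (maxn n0 1).
move=> [a b] [/= ]; rewrite !geq_max => /andP[an a1] /andP[bn b1] /andP[cab abC].
have b0 : 0 < b%:R :> R by rewrite ltr0n.
have a0 : 0 < a%:R :> R by rewrite ltr0n.
have aK : (a <= K * b)%N.
  rewrite -(ler_nat R) natrM; rewrite ler_pdivrMr // in abC.
  by apply: (le_trans abC); rewrite ler_wpM2r.
have bK : (b <= K * a)%N.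
  rewrite -(ler_nat R) natrM; rewrite ler_pdivlMr // in cab.
  apply: (@le_trans _ _ (c^-1 * a%:R)); last by rewrite ler_wpM2r.
  by rewrite mulrC ler_pdivlMr // mulrC.
have /andP[h1 h2] := tv_dist_bounds r0 a1 b1 (hn0 a b an bn aK bK).
by rewrite ger0_norm ?subr_ge0 //; lra.
Qed.

Theorem theoremA4 (R : realType) (r : R) (r_gt0 : 0 < r) (r_neq1 : r != 1) :
  lim_balanced (fun n => tv_dist (Pi R n) (Pmeas r n) (Pmeas 1 n)) 1 /\
  asymptotically_singular (Pi R) (Pmeas r) (Pmeas 1).
Proof. by split; exact: lim_tv_dist. Qed.
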